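(* Let $P=P_n(\{z_I\})$ be a generalized permutahedron contained in $\mathbb{R}^n_{>0}$, let $\pi=\pi_1|\cdots|\pi_k$ be an ordered partition of $[n]$ and $0\le q\le1$. Then \[ \mathrm{Vol}_n(P^\pi(q))=\frac{z_\pi}{\sqrt{|\pi_1|\cdots|\pi_k|}}\,\mathrm{Vol}_{n-k}(P_\pi)\int_q^1\int_q^{t_k}\cdots\int_q^{t_2}t_1^{|\pi_1|-1}\cdots t_k^{|\pi_k|-1}\,dt_1\cdots dt_k, \] where $z_\pi=z_\pi^{\pi_1}\cdots z_\pi^{\pi_k}$; in particular this volume is a polynomial in $q$.
   Context: For real numbers $z_I$ ($I\subseteq[n]$, $z_\emptyset=0$) let $P_n(\{z_I\})=\{t\in\mathbb{R}^n:\sum_{i=1}^n t_i=z_{[n]},\ \sum_{i\in I}t_i\ge z_I\ \forall I\subseteq[n]\}$; a generalized permutahedron is such a polytope with supermodular parameters. A linear functional $\sum a_ix_i$ has type $\pi$ if $a_i=a_j$ exactly when $i,j$ lie in the same block, and $a_i<a_j$ when $i\in\pi_s,j\in\pi_t$ with $s<t$; $P_\pi$ is the face of $P$ maximizing any functional of type $\pi$ (of dimension at most $n-k$; $\mathrm{Vol}_{n-k}$ is $(n-k)$-dimensional volume). For $i=0,\dots,k$, $P_\pi^i$ is obtained from $P_\pi$ by multiplying by $q$ the coordinates with indices in $\pi_1\cup\cdots\cup\pi_i$; the $(\pi,q)$-lifting is $P^\pi(q)=\mathrm{conv}(P_\pi^0\cup\cdots\cup P_\pi^k)\subset\mathbb{R}^n$.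 Also $z_\pi^{\pi_i}:=z_{\pi_1\cup\cdots\cup\pi_i}-z_{\pi_1\cup\cdots\cup\pi_{i-1}}$. *)

(* Defs.v *)
From HB Require Import structures.
From mathcomp Require Import all_boot all_order all_algebra.
From mathcomp Require Import all_classical all_reals all_analysis.

Set Implicit Arguments.
Unset Strict Implicit.
Unset Printing Implicit Defensive.

Import Order.TTheory GRing.Theory Num.Theory.
Import numFieldNormedType.Exports.

Local Open Scope classical_set_scope.
Local Open Scope ring_scope.

Section lebesgue_tuple.
Context {R : realType}.
Local Notation T := (measurableTypeR R).

Definition tcons n (x : T * n.-tuple T) : n.+1.-tuple T :=
  [the n.+1.-tuple T of x.1 :: x.2].

Section step.
Variables (n : nat) (m : {sigma_finite_measure set (n.-tuple T) -> \bar R}).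

Definition lebesgue_tuple_step : set (n.+1.-tuple T) -> \bar R :=
  pushforward (@lebesgue_measure R \x m)%E (@tcons n).

Let measurable_tcons : measurable_fun setT (@tcons n).
Proof. exact: measurable_cons. Qed.

Let step0 : lebesgue_tuple_step set0 = 0%E.
Proof. exact: measure0. Qed.

Let step_ge0 A : (0 <= lebesgue_tuple_step A)%E.
Proof. exact: measure_ge0. Qed.

Let step_sigma_additive : semi_sigma_additive lebesgue_tuple_step.
Proof.
exact: (@measure_semi_sigma_additive _ _ _
  (pushforward (@lebesgue_measure R \x m)%E (@tcons n))).
Qed.

HB.instance Definition _ := isMeasure.Build _ _ _ lebesgue_tuple_step
  step0 step_ge0 step_sigma_additive.

Let step_sigma_finite : sigma_finite setT lebesgue_tuple_step.
Proof.
pose g (t : n.+1.-tuple T) : T * n.-tuple T :=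
  (tnth t ord0, [tuple of behead t]).
have mg : measurable_fun setT g.
  by apply: measurable_fun_pair;
    [exact: measurable_tnth|exact: measurable_behead].
have gK : cancel (@tcons n) g by move=> [x t]; congr pair; exact: val_inj.
have /sigma_finiteP[F [TF ndF Foo]] := sigma_finiteT (@lebesgue_measure R).
have /sigma_finiteP[G [TG ndG Goo]] := sigma_finiteT m.
exists (fun i => g @^-1` (F i `*` G i)).
  rewrite -preimage_bigcup; apply/seteqP; split => // t _.
  have [i _ Fi] : (\bigcup_i F i) (g t).1 by rewrite -TF.
  have [j _ Gj] : (\bigcup_i G i) (g t).2 by rewrite -TG.
  exists (maxn i j) => //; split.
    by move: Fi; exact/subsetPset/ndF/leq_maxl.
  by move: Gj; exact/subsetPset/ndG/leq_maxr.
move=> i; have [mF Fi] := Foo i; have [mG Gi] := Goo i; split.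
  by rewrite -[_ @^-1` _]setTI; apply: mg => //; exact: measurableX.
rewrite /lebesgue_tuple_step /pushforward -comp_preimage.
rewrite (_ : g \o _ = id); last exact/funext.
by rewrite preimage_id product_measure1E// lte_mul_pinfty// ge0_fin_numE.
Qed.

HB.instance Definition _ :=
  @Measure_isSigmaFinite.Build _ _ _ lebesgue_tuple_step step_sigma_finite.

End step.

Fixpoint lebesgue_tuple n : {sigma_finite_measure set (n.-tuple T) -> \bar R} :=
  match n with
  | 0 => [the {sigma_finite_measure set (0.-tuple T) -> \bar R} of
           dirac [tuple]]
  | n'.+1 => [the {sigma_finite_measure set (n'.+1.-tuple T) -> \bar R} of
           lebesgue_tuple_step (lebesgue_tuple n')]
  end.

End lebesgue_tuple.

Section euclidean_volume.
Context {R : realType}.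

Definition lebesgue_row n (A : set 'rV[R]_n) : \bar R :=
  lebesgue_tuple n [set t | A (\row_i tnth t i)].

Definition flat_chart d n (M : 'M[R]_(d, n)) (b : 'rV[R]_n) (u : 'rV[R]_d)
  : 'rV[R]_n := b + u *m M.

(* The d-dimensional volume of a Borel set A contained in a d-dimensional
   affine subspace of R^n is the Lebesgue measure of A read in orthonormal
   affine coordinates of that subspace (the rows of M are orthonormal).  The
   set of values below is then a singleton, since Lebesgue measure is invariant
   under isometries and A is null in every chart when it spans less than d
   dimensions.  It is empty, and the default 0 is returned, if A lies in no
   d-dimensional affine subspace. *)
Definition flat_volume d n (A : set 'rV[R]_n) : \bar R :=
  xget 0%E [set v | exists (M : 'M[R]_(d, n)) (b : 'rV[R]_n),
    [/\ M *m M^T = 1%:M, A `<=` range (flat_chart M b) &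
        v = lebesgue_row (flat_chart M b @^-1` A)]].

Definition convex_hull n (A : set 'rV[R]_n) : set 'rV[R]_n :=
  smallest (@convex_set R 'rV[R]_n) A.

End euclidean_volume.

Section generalized_permutahedra.
Context {R : realType} {n : nat}.

Definition polytope_of (z : {set 'I_n} -> R) : set 'rV[R]_n :=
  [set t | \sum_i t 0 i = z [set: 'I_n]%SET /\
           forall I : {set 'I_n}, z I <= \sum_(i in I) t 0 i].

Definition supermodular (z : {set 'I_n} -> R) :=
  forall I J : {set 'I_n}, z I + z J <= z (I :|: J)%SET + z (I :&: J)%SET.

Definition dotv (a x : 'rV[R]_n) : R := \sum_i a 0 i * x 0 i.

Definition max_face (P : set 'rV[R]_n) (a : 'rV[R]_n) : set 'rV[R]_n :=
  [set x | P x /\ forall y, P y -> dotv a y <= dotv a x].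

Definition scale_coords (q : R) (I : {set 'I_n}) (x : 'rV[R]_n) : 'rV[R]_n :=
  \row_i (if i \in I then q * x 0 i else x 0 i).

Section ordered_partitions.
Context {k : nat}.

Definition ordered_partition (pi : 'I_k -> {set 'I_n}) :=
  injective pi /\ finset.partition [set pi s | s : 'I_k]%SET [set: 'I_n]%SET.

Definition has_type (pi : 'I_k -> {set 'I_n}) (a : 'rV[R]_n) :=
  (forall i j, a 0 i = a 0 j <-> exists s, i \in pi s /\ j \in pi s) /\
  (forall (s t : 'I_k) i j,
     (s < t)%N -> i \in pi s -> j \in pi t -> a 0 i < a 0 j).

(* Union of the first r blocks, i.e. of the blocks with (0-based) index < r. *)
Definition first_blocks (pi : 'I_k -> {set 'I_n}) (r : nat) : {set 'I_n} :=
  (\bigcup_(s < k | (s < r)%N) pi s)%SET.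

(* F is meant to be the face of type pi. *)
Definition lifting (pi : 'I_k -> {set 'I_n}) (q : R) (F : set 'rV[R]_n) :
    set 'rV[R]_n :=
  convex_hull (\bigcup_(r in [set r : nat | (r <= k)%N])
                 scale_coords q (first_blocks pi r) @` F).

Definition block_height (z : {set 'I_n} -> R) (pi : 'I_k -> {set 'I_n})
    (s : 'I_k) : R :=
  z (first_blocks pi s.+1) - z (first_blocks pi s).

End ordered_partitions.

End generalized_permutahedra.

(* rev_iterated_integral q [:: c_k; ...; c_1] u is
   \int_q^u \int_q^(t_k) ... \int_q^(t_2)
     t_1 ^ (c_1 - 1) ... t_k ^ (c_k - 1) dt_1 ... dt_k. *)
Fixpoint rev_iterated_integral (R : realType) (q : R) (c : seq nat) (u : R)
  : R :=
  match c with
  | [::] => 1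
  | m :: c' => \int[lebesgue_measure]_(t in `[q, u])
                 (t ^+ m.-1 * rev_iterated_integral q c' t)
  end.

Definition iterated_integral (R : realType) (q : R) k (c : 'I_k -> nat) : R :=
  rev_iterated_integral q (rev [seq c s | s <- enum 'I_k]) 1.

(* Main.v *)
(* By supermodularity the face of type pi consists of the points for which all
   the constraints z_(pi_1 u ... u pi_r) are tight, and it is a product of one
   generalized permutahedron per block, the coordinates of the s-th block
   summing up to h_s = z_pi^(pi_s).  Hence the lifting is the set of the points
   obtained by scaling the blocks of a point of the face by factors
   q <= t_1 <= ... <= t_k <= 1, and t_s is read off as (sum of block s) / h_s.
   Let M be an orthonormal basis of the space of vectors with zero block sums.
   In the coordinates (t, v) |-> sum_s t_s (h_s / |pi_s|) 1_(pi_s) + v M, whose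
   determinant is prod_s h_s / sqrt |pi_s|, the slice of the lifting at t is a
   linear copy of the face, read in the chart M, with volume factor
   prod_s t_s ^ (|pi_s| - 1); Fubini's theorem concludes.
   Linear maps scale volumes by |det|: this is Fubini's theorem applied to each
   step of Gaussian elimination.  Any orthonormal chart may be used for the
   face, since the face is null in two charts unless they span the same flat. *)
Require Import Defs.
From mathcomp Require Import all_boot all_order all_algebra.
From mathcomp Require Import all_classical all_reals all_analysis.
From mathcomp Require Import measurable_realfun ring lra.

Set Implicit Arguments.
Unset Strict Implicit.
Unset Printing Implicit Defensive.

Import Order.TTheory GRing.Theory Num.Theory.
Import numFieldNormedType.Exports.

Local Open Scope classical_set_scope.
Local Open Scope ring_scope.

(** * Lebesgue measure on row vectors *)

Section measurable_rows.
Context {R : realType}.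
Local Notation T := (measurableTypeR R).

Definition row_of_tuple n (t : n.-tuple T) : 'rV[R]_n := \row_i tnth t i.

(* Rows carry no sigma-algebra here: as in [lebesgue_row], measurability is that
   of the corresponding set or function of tuples. *)
Definition measurable_rows n (A : set 'rV[R]_n) : Prop :=
  measurable (@row_of_tuple n @^-1` A).

Definition measurable_row_fun n (f : 'rV[R]_n -> R) : Prop :=
  measurable_fun setT (f \o @row_of_tuple n : n.-tuple T -> T).

Lemma measurable_row_fun_cst n (c : R) :
  measurable_row_fun (fun _ : 'rV[R]_n => c).
Proof. exact: measurable_cst. Qed.

Lemma measurable_row_fun_coord n (i : 'I_n) :
  measurable_row_fun (fun x => x 0 i).
Proof.
rewrite /measurable_row_fun (_ : _ \o _ = fun t => tnth t i).
  exact: measurable_tnth.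
by apply/funext => t /=; rewrite mxE.
Qed.

Lemma measurable_row_funD n (f g : 'rV[R]_n -> R) :
  measurable_row_fun f -> measurable_row_fun g ->
  measurable_row_fun (fun x => f x + g x).
Proof. by move=> mf mg; exact: measurable_funD. Qed.

Lemma measurable_row_funM n (f g : 'rV[R]_n -> R) :
  measurable_row_fun f -> measurable_row_fun g ->
  measurable_row_fun (fun x => f x * g x).
Proof. by move=> mf mg; exact: measurable_funM. Qed.

Lemma measurable_row_fun_sum n (I : finType) (P : pred I)
    (f : I -> 'rV[R]_n -> R) :
  (forall i, measurable_row_fun (f i)) ->
  measurable_row_fun (fun x => \sum_(i | P i) f i x).
Proof.
move=> mf; rewrite /measurable_row_fun.
under eq_fun do rewrite /= big_mkcond.
apply: (measurable_sum _ (h := fun i t =>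
  if P i then f i (row_of_tuple t) else 0)) => i.
by case: (P i); [exact: mf|exact: measurable_cst].
Qed.

Lemma measurable_rowsI n (A B : set 'rV[R]_n) :
  measurable_rows A -> measurable_rows B -> measurable_rows (A `&` B).
Proof. exact: measurableI. Qed.

Lemma measurable_rows_forall n (I : finType) (A : I -> set 'rV[R]_n) :
  (forall i, measurable_rows (A i)) ->
  measurable_rows [set x | forall i, A i x].
Proof.
move=> mA; rewrite /measurable_rows.
rewrite (_ : _ @^-1` _ = \bigcap_(i in [set: I]) (@row_of_tuple n @^-1` A i)).
  by apply: fin_bigcap_measurable => // i _; exact: mA.
by apply/seteqP; split => t /= At i;
  [move=> _; exact: At|exact: (At i Logic.I)].
Qed.

Lemma measurable_rows_imply n (P : Prop) (A : set 'rV[R]_n) :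
  measurable_rows A -> measurable_rows [set x | P -> A x].
Proof.
have [p mA|np _] := pselect P.
  by rewrite (_ : [set x | _] = A)//; apply/seteqP; split => x //= /(_ p).
rewrite (_ : [set x | _] = setT); first exact: measurableT.
by apply/seteqP; split => x //= _ /np.
Qed.

Lemma measurable_rows_le n (f g : 'rV[R]_n -> R) :
  measurable_row_fun f -> measurable_row_fun g ->
  measurable_rows [set x | f x <= g x].
Proof.
move=> mf mg; rewrite /measurable_rows -[X in measurable X]setTI.
by have := measurable_fun_ler mf mg measurableT (Y := [set true]); apply.
Qed.

Lemma measurable_rows_eq n (f g : 'rV[R]_n -> R) :
  measurable_row_fun f -> measurable_row_fun g ->
  measurable_rows [set x | f x = g x].
Proof.
move=> mf mg; have := measurable_rowsI
  (measurable_rows_le mf mg) (measurable_rows_le mg mf).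
congr measurable_rows; apply/seteqP; split => x /= => [[fg gf]|->//].
by apply/le_anti/andP.
Qed.

Lemma measurable_rows_preimage n p (f : 'rV[R]_n -> 'rV[R]_p) A :
  (forall j, measurable_row_fun (fun x => f x 0 j)) ->
  measurable_rows A -> measurable_rows (f @^-1` A).
Proof.
move=> mf mA; pose g (t : n.-tuple T) : p.-tuple T :=
  [tuple f (row_of_tuple t) 0 j | j < p].
have gE : @row_of_tuple p \o g = f \o @row_of_tuple n.
  by apply/funext => t; apply/rowP => j; rewrite mxE tnth_mktuple.
have mg : measurable_fun setT g.
  apply/measurable_fun_tnthP => j.
  rewrite (_ : _ \o g = fun t => f (row_of_tuple t) 0 j); first exact: mf.
  by apply/funext => t /=; rewrite tnth_mktuple.
rewrite /measurable_rows -comp_preimage -gE comp_preimage.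
by rewrite -[X in measurable X]setTI; exact: mg.
Qed.

Lemma measurable_rows_affine n p (B : 'M[R]_(n, p)) (c : 'rV[R]_p) A :
  measurable_rows A -> measurable_rows [set x | A (x *m B + c)].
Proof.
apply: (@measurable_rows_preimage _ _ (fun x => x *m B + c)) => j.
under eq_fun do rewrite !mxE; apply: measurable_row_funD.
  apply: measurable_row_fun_sum => i; apply: measurable_row_funM.
    exact: measurable_row_fun_coord.
  exact: measurable_row_fun_cst.
exact: measurable_row_fun_cst.
Qed.

Lemma measurable_rows_mulmx n p (B : 'M[R]_(n, p)) A :
  measurable_rows A -> measurable_rows [set x | A (x *m B)].
Proof.
move=> /(measurable_rows_affine B 0); congr measurable_rows.
by apply/seteqP; split => x /=; rewrite addr0.
Qed.

Lemma measurable_rows_translate n (c : 'rV[R]_n) A :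
  measurable_rows A -> measurable_rows [set x | A (x + c)].
Proof.
move=> /(measurable_rows_affine 1%:M c); congr measurable_rows.
by apply/seteqP; split => x /=; rewrite mulmx1.
Qed.

End measurable_rows.

Section lebesgue_row.
Context {R : realType}.
Local Notation T := (measurableTypeR R).

Lemma lebesgue_rowE n (A : set 'rV[R]_n) :
  lebesgue_row A = lebesgue_tuple n (@row_of_tuple R n @^-1` A).
Proof. by []. Qed.

Lemma lebesgue_row_ge0 n (A : set 'rV[R]_n) : (0 <= lebesgue_row A)%E.
Proof. exact: measure_ge0. Qed.

Lemma lebesgue_row_set0 n : lebesgue_row (@set0 'rV[R]_n) = 0%E.
Proof. by rewrite lebesgue_rowE preimage_set0 measure0. Qed.

Lemma le_lebesgue_row n (A B : set 'rV[R]_n) :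
  measurable_rows A -> measurable_rows B -> A `<=` B ->
  (lebesgue_row A <= lebesgue_row B)%E.
Proof.
move=> mA mB AB; rewrite !lebesgue_rowE; apply: le_measure; rewrite ?inE//.
by move=> t; exact: AB.
Qed.

Definition row_slice m n (A : set 'rV[R]_(m + n)) (s : 'rV[R]_m) :
  set 'rV[R]_n :=
  [set v | A (row_mx s v)].

Definition row_line n (A : set 'rV[R]_(1 + n)) (v : 'rV[R]_n) : set T :=
  [set x | A (row_mx (x%:M : 'rV_1) v)].

Lemma row_mx_scalarEl n (x : R) (v : 'rV[R]_n) :
  row_mx (x%:M : 'rV_1) v 0 (lshift n 0) = x.
Proof. by rewrite row_mxEl !mxE mulr1n. Qed.

Lemma measurable_row_slice m n (A : set 'rV[R]_(m + n)) s :
  measurable_rows A -> measurable_rows (row_slice A s).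
Proof.
move=> /(measurable_rows_affine (row_mx 0 1%:M) (row_mx s 0)).
congr measurable_rows; apply/seteqP; split => v /=;
  by rewrite mul_mx_row mulmx0 mulmx1 add_row_mx add0r addr0.
Qed.

Section fubini.
Variables (n : nat) (A : set 'rV[R]_(1 + n)).
Hypothesis mA : measurable_rows A.

Let A_pairs : set (T * n.-tuple T) :=
  @tcons R n @^-1` (@row_of_tuple R (1 + n) @^-1` A).

Let measurable_A_pairs : measurable A_pairs.
Proof.
rewrite -[X in measurable X]setTI.
have mt : measurable_fun setT (@tcons R n) by exact: measurable_cons.
exact: mt.
Qed.

Let A_pairsE (x : T) (t : n.-tuple T) :
  A_pairs (x, t) = A (row_mx (x%:M : 'rV_1) (row_of_tuple t)).
Proof.
rewrite /A_pairs /=; congr A; apply/rowP => i; rewrite !mxE.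
case: splitP => j ij; rewrite !mxE.
  by rewrite (ord1 j) in ij *; rewrite mulr1n (_ : i = ord0)//; exact/val_inj.
by rewrite (_ : i = lift ord0 j) ?tnthS//; exact/val_inj.
Qed.

Let xsection_pairs (x : T) : xsection A_pairs x =
  @row_of_tuple R n @^-1` row_slice A (x%:M : 'rV_1).
Proof. by apply/seteqP; split => t; rewrite /xsection /= inE A_pairsE. Qed.

Let ysection_pairs (t : n.-tuple T) :
  ysection A_pairs t = row_line A (row_of_tuple t).
Proof. by apply/seteqP; split => x; rewrite /ysection /= inE A_pairsE. Qed.

Lemma measurable_lebesgue_row_slice :
  measurable_fun setT (fun x : T => lebesgue_row (row_slice A (x%:M : 'rV_1))).
Proof.
have := measurable_fun_xsection (lebesgue_tuple n) measurable_A_pairs.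
by congr measurable_fun; apply/funext => x /=; rewrite xsection_pairs.
Qed.

Lemma measurable_row_line (t : n.-tuple T) :
  measurable (row_line A (row_of_tuple t)).
Proof. by rewrite -ysection_pairs; exact: measurable_ysection. Qed.

Lemma measurable_lebesgue_row_line : measurable_fun setT
  (fun t : n.-tuple T => lebesgue_measure (row_line A (row_of_tuple t))).
Proof.
have := measurable_fun_ysection (@lebesgue_measure R) measurable_A_pairs.
by congr measurable_fun; apply/funext => t /=; rewrite ysection_pairs.
Qed.

Lemma lebesgue_row_integral_slice : lebesgue_row A =
  (\int[lebesgue_measure]_x lebesgue_row (row_slice A (x%:M : 'rV_1)))%E.
Proof.
rewrite lebesgue_rowE /= /lebesgue_tuple_step /pushforward /product_measure1.
by apply: eq_integral => x _ /=; rewrite -/A_pairs xsection_pairs.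
Qed.

Lemma lebesgue_row_integral_line : lebesgue_row A =
  (\int[lebesgue_tuple n]_t lebesgue_measure (row_line A (row_of_tuple t)))%E.
Proof.
rewrite lebesgue_row_integral_slice.
have := indic_fubini_tonelli (@lebesgue_measure R) (lebesgue_tuple n)
  measurable_A_pairs.
rewrite (indic_fubini_tonelli_FE _ measurable_A_pairs).
rewrite (indic_fubini_tonelli_GE _ measurable_A_pairs) => tonelli.
transitivity (\int[lebesgue_measure]_x
    (lebesgue_tuple n \o xsection A_pairs) x)%E.
  by apply: eq_integral => x _ /=; rewrite xsection_pairs.
by rewrite tonelli; apply: eq_integral => t _ /=; rewrite ysection_pairs.
Qed.

End fubini.
End lebesgue_row.

(** * Linear change of variables *)

Lemma lebesgue_measure_affine (R : realType) (a b : R)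
    (A : set (measurableTypeR R)) : a != 0 -> measurable A ->
  lebesgue_measure [set x : measurableTypeR R | A (a * x + b)] =
    (`|a|^-1%:E * lebesgue_measure A)%E.
Proof.
move=> a0 mA; pose f (x : measurableTypeR R) : measurableTypeR R := a * x + b.
have mf : measurable_fun setT f.
  by apply: measurable_funD => //; exact: mulrl_measurable.
have f_itv u v : lebesgue_measure (`]u, v]%classic : set R) =
    (`|a|%:E * lebesgue_measure (f @^-1` `]u, v]%classic))%E.
  have [a_gt0|a_lt0] : 0 < a \/ a < 0.
    by move: a0; rewrite neq_lt => /orP[]; [right|left].
  - rewrite (_ : _ @^-1` _ = `](u - b) / a, (v - b) / a]%classic).
      rewrite [LHS]lebesgue_measure_itv lebesgue_measure_itv/= !lte_fin.
      rewrite ltr_pM2r ?invr_gt0// ltrD2r gtr0_norm//.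
      by case: ifPn => _; rewrite ?mule0// -!EFinB -EFinM; congr EFin; field.
    apply/seteqP; split => x /=; rewrite !in_itv/= ltr_pdivrMr// ler_pdivlMr//;
      by rewrite /f ltrBlDr lerBrDr [x * a]mulrC.
  - rewrite (_ : _ @^-1` _ = `[(v - b) / a, (u - b) / a[%classic).
      rewrite [LHS]lebesgue_measure_itv lebesgue_measure_itv/= !lte_fin.
      rewrite ltr_nM2r ?invr_lt0// ltrD2r ltr0_norm//.
      by case: ifPn => _; rewrite ?mule0// -!EFinB -EFinM; congr EFin; field.
    apply/seteqP; split => x /=; rewrite !in_itv/= ltr_ndivlMr// ler_ndivrMr//;
      by rewrite /f ltrBlDr lerBrDr [x * a]mulrC andbC.
have := @lebesgue_measure_unique R
  (mscale (NngNum (normr_ge0 a)) (pushforward lebesgue_measure f)) _ A mA.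
move=> /(_ mf) -> => [|_ [[u v]] _ <-]; last exact: f_itv.
by rewrite /mscale/= /pushforward muleA -EFinM mulVf ?normr_eq0// mul1e.
Qed.

Lemma exists_shear_pivot (F : fieldType) n (A : 'M[F]_(1 + n)) : A \in unitmx ->
  exists e : 'rV[F]_n, (block_mx (1%:M : 'M[F]_1) e 0 1%:M *m A) 0 0 != 0.
Proof.
move=> Au; have shear00 e : (block_mx (1%:M : 'M[F]_1) e 0 1%:M *m A) 0 0 =
    A 0 0 + (e *m dlsubmx A) 0 0.
  rewrite (_ : 0 = lshift n 0 :> 'I_(1 + n)); last exact/val_inj.
  by rewrite -{1}[A]submxK mulmx_block block_mxEul mul1mx !mxE.
have [a0|a0] := eqVneq (A 0 0) 0; last first.
  by exists 0; rewrite shear00 mul0mx mxE addr0.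
have [i li0] : exists i, dlsubmx A i 0 != 0.
  apply/existsP; apply: contraLR Au; rewrite negb_exists => /forallP l0.
  have dl0 : dlsubmx A = 0.
    by apply/colP => j; rewrite [RHS]mxE; move: (l0 j); rewrite negbK => /eqP.
  have ul0 : ulsubmx A = 0.
    rewrite [LHS]mx11_scalar !mxE (_ : lshift n 0 = 0 :> 'I_(1 + n));
      last exact/val_inj.
    by rewrite a0 raddf0.
  by rewrite unitmxE unitfE negbK -[A]submxK ul0 dl0 det_ublock det_mx11 mxE
    mul0r.
by exists (delta_mx 0 i); rewrite shear00 a0 add0r -rowE mxE.
Qed.

Section linear_change_of_variables.
Context {R : realType}.

Lemma lebesgue_row_translate n (c : 'rV[R]_n) S : measurable_rows S ->
  lebesgue_row [set x | S (x + c)] = lebesgue_row S.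
Proof.
elim: n c S => [|n IH] c S mS.
  by congr lebesgue_row; apply/seteqP; split => x /=;
    rewrite [x + c]thinmx0 [x]thinmx0.
rewrite -[n.+1]/(1 + n)%N in c S mS *.
rewrite -[c]hsubmxK; move: (lsubmx c) (rsubmx c) => c0 c'.
have mS0 := measurable_rows_translate (row_mx c0 0) mS.
have -> : lebesgue_row [set x | S (x + row_mx c0 c')] =
    lebesgue_row [set x | S (x + row_mx c0 0)].
  rewrite !lebesgue_row_integral_slice//; apply: eq_integral => x _.
  rewrite -(IH c' (row_slice [set y | S (y + row_mx c0 0)] x%:M)); last first.
    exact: measurable_row_slice.
  by congr lebesgue_row; apply/seteqP; split => v;
    rewrite /row_slice /= !add_row_mx addr0.
rewrite !lebesgue_row_integral_line//; apply: eq_integral => t _.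
have := lebesgue_measure_affine (c0 0 0) (oner_neq0 R)
  (measurable_row_line mS t).
rewrite normr1 invr1 mul1e => <-; congr lebesgue_measure.
by apply/seteqP; split => x;
  rewrite /row_line /= add_row_mx addr0 mul1r raddfD /= -mx11_scalar.
Qed.

Definition scales_volume n (A : 'M[R]_n) (a : R) : Prop :=
  forall S, measurable_rows S ->
    lebesgue_row [set x | S (x *m A)] = (a%:E * lebesgue_row S)%E.

Lemma scales_volume_mulmx n (A B : 'M[R]_n) (a b : R) :
  scales_volume A a -> scales_volume B b -> scales_volume (A *m B) (a * b).
Proof.
move=> scA scB S mS; rewrite EFinM -muleA -scB// -scA.
  by congr lebesgue_row; apply/seteqP; split => x /=; rewrite mulmxA.
exact: measurable_rows_mulmx.
Qed.

Lemma scales_volume_ublock n (b : 'rV[R]_n) (D : 'M[R]_n) (a : R) :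
  0 <= a -> scales_volume D a ->
  scales_volume (block_mx (1%:M : 'M[R]_1) b 0 D) a.
Proof.
move=> a0 scD S mS; have mAS := measurable_rows_mulmx (block_mx 1%:M b 0 D) mS.
rewrite !lebesgue_row_integral_slice// -ge0_integralZl//; last first.
  exact: measurable_lebesgue_row_slice.
apply: eq_integral => x _; have mSx := measurable_row_slice x%:M mS.
rewrite -(lebesgue_row_translate (x%:M *m b) mSx) -scD; last first.
  exact: measurable_rows_translate.
congr lebesgue_row; apply/seteqP; split => v; rewrite /row_slice /=;
  by rewrite mul_row_block mulmx0 mulmx1 addr0 addrC.
Qed.

Lemma scales_volume_lblock n (a : R) (l : 'cV[R]_n) : a != 0 ->
  scales_volume (block_mx (a%:M : 'M[R]_1) 0 l 1%:M) `|a|^-1.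
Proof.
move=> a0 S mS; have mAS := measurable_rows_mulmx (block_mx a%:M 0 l 1%:M) mS.
rewrite !lebesgue_row_integral_line// -ge0_integralZl//; last first.
  exact: measurable_lebesgue_row_line.
apply: eq_integral => t _; have mSt := measurable_row_line mS t.
rewrite -(lebesgue_measure_affine ((row_of_tuple t *m l) 0 0) a0 mSt).
congr lebesgue_measure; apply/seteqP; split => x;
  rewrite /row_line /= mul_row_block !mulmx0 mulmx1 add0r -scalar_mxM mulrC;
  by rewrite [row_of_tuple t *m l]mx11_scalar -raddfD/=
    [(_%:M : 'M[R]_1) 0 0]mxE.
Qed.

(* One step of Gaussian elimination:
   A = [[a, b], [l, D]] = [[a, 0], [l, 1]] [[1, b / a], [0, D - l b / a]]. *)
Lemma scales_volume_pivot n (A : 'M[R]_(1 + n)) :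
  (forall D : 'M[R]_n, D \in unitmx -> scales_volume D `|\det D|^-1) ->
  A \in unitmx -> A 0 0 != 0 -> scales_volume A `|\det A|^-1.
Proof.
move=> scD Au a0; set a := A 0 0 in a0.
pose b := a^-1 *: ursubmx A; pose l := dlsubmx A; pose E := drsubmx A - l *m b.
have AE : A =
    block_mx (a%:M : 'M[R]_1) 0 l 1%:M *m block_mx (1%:M : 'M[R]_1) b 0 E.
  rewrite mulmx_block !mulmx0 !mul0mx !mulmx1 !addr0 mul1mx /E addrC subrK.
  rewrite mul_scalar_mx scalerA mulfV// scale1r -[LHS]submxK; congr block_mx.
  by rewrite [LHS]mx11_scalar !mxE; congr (A _ _)%:M; apply/val_inj.
have detA : \det A = a * \det E.
  by rewrite AE det_mulmx det_lblock det_ublock !det1 !mul1r det_scalar1 mulr1.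
have Eu : E \in unitmx.
  by move: Au; rewrite !unitmxE !unitfE detA mulf_eq0 negb_or => /andP[].
rewrite detA normrM invfM AE; apply: scales_volume_mulmx.
  exact: scales_volume_lblock.
by apply: scales_volume_ublock; [rewrite invr_ge0|exact: scD].
Qed.

Theorem scales_volume_unitmx n (A : 'M[R]_n) :
  A \in unitmx -> scales_volume A `|\det A|^-1.
Proof.
elim: n A => [A _ S mS|n IH]; last rewrite -[n.+1]/(1 + n)%N => A Au.
  rewrite det_mx00 normr1 invr1 mul1e; congr lebesgue_row.
  by apply/seteqP; split => x /=; rewrite [x *m A]thinmx0 [x]thinmx0.
pose shear (e : 'rV[R]_n) : 'M[R]_(1 + n) := block_mx 1%:M e 0 1%:M.
have det_shear e : \det (shear e) = 1 by rewrite det_ublock !det1 mulr1.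
have shearK e : shear (- e) *m shear e = 1%:M.
  rewrite mulmx_block !mulmx0 !mul0mx !mulmx1 !mul1mx !addr0 add0r subrr.
  by rewrite -scalar_mx_block.
have [e pivot_neq0] := exists_shear_pivot Au; rewrite -/(shear e) in pivot_neq0.
have -> : A = shear (- e) *m (shear e *m A) by rewrite mulmxA shearK mul1mx.
rewrite det_mulmx normrM invfM det_shear normr1 invr1;
  apply: scales_volume_mulmx.
  apply: scales_volume_ublock => //.
  by have := IH 1%:M (unitmx1 _ _); rewrite det1 normr1 invr1.
apply: scales_volume_pivot => //.
by rewrite unitmx_mul Au andbT unitmxE det_shear unitr1.
Qed.

End linear_change_of_variables.

(** * Null sets and bounded sets *)

Section null_and_bounded_sets.
Context {R : realType}.

Lemma measurable_row_fun_dotv n (w : 'rV[R]_n) : measurable_row_fun (dotv w).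
Proof.
apply: measurable_row_fun_sum => i; apply: measurable_row_funM.
  exact: measurable_row_fun_cst.
exact: measurable_row_fun_coord.
Qed.

Lemma dotv_mulmx n (w x : 'rV[R]_n) : dotv w x = (x *m w^T) 0 0.
Proof. by rewrite mxE; apply: eq_bigr => i _; rewrite mxE mulrC. Qed.

Lemma measurable_hyperplane n (w : 'rV[R]_n) (c : R) :
  measurable_rows [set x | dotv w x = c].
Proof.
apply: measurable_rows_eq; first exact: measurable_row_fun_dotv.
exact: measurable_row_fun_cst.
Qed.

Lemma lebesgue_row_hyperplane n (w : 'rV[R]_n) (c : R) :
  w != 0 -> lebesgue_row [set x | dotv w x = c] = 0%E.
Proof.
elim: n w c => [w c|n IH]; first by rewrite thinmx0 eqxx.
rewrite -[n.+1]/(1 + n)%N => w c.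
rewrite -[w]hsubmxK; move: (lsubmx w) (rsubmx w) => w0 w' w_neq0.
have dotv_row_mx x v : dotv (row_mx w0 w') (row_mx (x%:M : 'rV_1) v) =
    x * w0 0 0 + dotv w' v.
  by rewrite !dotv_mulmx tr_row_mx mul_row_col mul_scalar_mx !mxE.
have mH := measurable_hyperplane (row_mx w0 w') c.
have [w00|w00] := eqVneq (w0 0 0) 0.
  rewrite lebesgue_row_integral_slice// integral0_eq// => x _.
  rewrite -(IH w' c); last first.
    apply: contraNneq w_neq0 => ->.
    by rewrite [w0]mx11_scalar w00 raddf0 row_mx0.
  by congr lebesgue_row; apply/seteqP; split => v;
    rewrite /row_slice /= dotv_row_mx w00 mulr0 add0r.
rewrite lebesgue_row_integral_line// integral0_eq// => t _.
pose x0 := (c - dotv w' (row_of_tuple t)) / w0 0 0.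
rewrite (_ : row_line _ _ = [set x0])%classic.
  exact: lebesgue_measure_set1.
apply/seteqP; split => x; rewrite /row_line /= dotv_row_mx.
  by rewrite /x0 => <-; rewrite addrK mulfK.
by move=> ->; rewrite /x0 divfK// subrK.
Qed.

Lemma lebesgue_row_sub_ker n m (N : 'M[R]_(n, m)) A :
  N != 0 -> measurable_rows A -> (forall x, A x -> x *m N = 0) ->
  lebesgue_row A = 0%E.
Proof.
move=> N0 mA AN; have [j Nj0] : exists j, col j N != 0.
  apply/existsP; apply: contraNT N0; rewrite negb_exists => /forallP col0.
  apply/eqP/matrixP => i j; have := col0 j; rewrite negbK => /eqP/colP/(_ i).
  by rewrite !mxE.
have Nj_neq0 : (col j N)^T != 0 by rewrite trmx_eq0.
apply/eqP; rewrite eq_le lebesgue_row_ge0 andbT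
  -(lebesgue_row_hyperplane 0 Nj_neq0).
apply: le_lebesgue_row => // [|x Ax]; first exact: measurable_hyperplane.
by rewrite /= dotv_mulmx trmxK colE mulmxA AN// mul0mx mxE.
Qed.

Definition row_box n (C : R) : set 'rV[R]_n :=
  [set x | forall i, `|x 0 i| <= C].

Lemma measurable_row_box n C : measurable_rows (@row_box n C).
Proof.
apply: measurable_rows_forall => i.
have mi := @measurable_row_fun_coord R n i.
have := measurable_rowsI (measurable_rows_le (measurable_row_fun_cst (- C)) mi)
  (measurable_rows_le mi (measurable_row_fun_cst C)).
congr measurable_rows; apply/seteqP; split => x /=; rewrite ler_norml.
  by move=> [-> ->].
by move=> /andP.
Qed.

Lemma row_slice_box n C x : row_slice (@row_box (1 + n) C) x%:M =
  if `|x| <= C then @row_box n C else set0.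
Proof.
case: ifPn => xC; apply/seteqP; split => v // box_v.
- by move=> i; have := box_v (rshift 1 i); rewrite row_mxEr.
- move=> i; case: (split_ordP i) => j ->; last by rewrite row_mxEr.
  by rewrite ord1 row_mx_scalarEl.
- by move/negP: xC; apply; have := box_v (lshift n 0); rewrite row_mx_scalarEl.
Qed.

Lemma lebesgue_row_box_lty n C : (lebesgue_row (@row_box n C) < +oo)%E.
Proof.
elim: n => [|n IH].
  apply: le_lt_trans (ltry 1); rewrite lebesgue_rowE /= diracE.
  by case: (_ \in _).
rewrite -[n.+1]/(1 + n)%N lebesgue_row_integral_slice.
rewrite (_ : (\int[_]_x _)%E =
    (\int[lebesgue_measure]_(x in `[(- C)%R, C])
       lebesgue_row (@row_box n C))%E); last first.
  rewrite [RHS]integral_mkcond; apply: eq_integral => x _.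
  rewrite row_slice_box patchE mem_setE in_itv/= -ler_norml.
  by case: ifP => // _; rewrite lebesgue_row_set0.
rewrite integral_cst//= lebesgue_measure_itv/= lte_fin.
rewrite lte_mul_pinfty ?lebesgue_row_ge0//; last first.
  by case: ifP => _; rewrite ?lte_ninfty -?EFinB ltry.
by rewrite ge0_fin_numE ?lebesgue_row_ge0.
Qed.

Lemma lebesgue_row_bounded_lty n (A : set 'rV[R]_n) C : measurable_rows A ->
  (forall x, A x -> forall i, `|x 0 i| <= C) -> (lebesgue_row A < +oo)%E.
Proof.
move=> mA AC; apply: le_lt_trans (lebesgue_row_box_lty n C).
exact: le_lebesgue_row mA (measurable_row_box C) AC.
Qed.

End null_and_bounded_sets.

(** * Volume in affine charts *)

Section flat_charts.
Context {R : realType} {d n : nat}.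
Implicit Types (M : 'M[R]_(d, n)) (A : set 'rV[R]_n) (b p : 'rV[R]_n).

Lemma flat_chartK M b : M *m M^T = 1%:M ->
  cancel (flat_chart M b) (fun x => (x - b) *m M^T).
Proof.
by move=> orthoM u; rewrite /flat_chart [b + _]addrC addrK -mulmxA orthoM
  mulmx1.
Qed.

Lemma measurable_flat_chart M b A :
  measurable_rows A -> measurable_rows (flat_chart M b @^-1` A).
Proof.
move=> /(measurable_rows_affine M b); congr measurable_rows.
by apply/seteqP; split => u /=; rewrite /flat_chart addrC.
Qed.

Lemma flat_chart_rebase M b p : range (flat_chart M b) p ->
  exists w, forall u, flat_chart M p u = flat_chart M b (u + w).
Proof.
move=> [w _ <-]; exists w => u; rewrite /flat_chart mulmxDl addrA.
by rewrite addrAC.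
Qed.

Lemma lebesgue_row_rebase M b p A : measurable_rows A ->
  range (flat_chart M b) p ->
  lebesgue_row (flat_chart M p @^-1` A) = lebesgue_row (flat_chart M b @^-1` A).
Proof.
move=> mA /flat_chart_rebase[w chartE].
rewrite -(lebesgue_row_translate w (measurable_flat_chart M b mA)).
by congr lebesgue_row; apply/seteqP; split => u /=; rewrite chartE.
Qed.

Lemma range_flat_chart_rebase M b p :
  range (flat_chart M b) p ->
  range (flat_chart M b) `<=` range (flat_chart M p).
Proof.
move=> /flat_chart_rebase[w chartE] _ [u _ <-].
by exists (u - w) => //; rewrite chartE subrK.
Qed.

Lemma flat_chart_transition M M' p u : M' *m M'^T = 1%:M ->
  range (flat_chart M' p) (flat_chart M p u) ->
  flat_chart M' p (u *m (M *m M'^T)) = flat_chart M p u.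
Proof.
move=> orthoM' [u' _ u'E]; rewrite -u'E; congr flat_chart.
rewrite -[u'](flat_chartK p orthoM') u'E.
by rewrite /flat_chart [p + _]addrC addrK mulmxA.
Qed.

(* M *m M'^T turns M-coordinates into M'-coordinates.  On [A] going to
   M'-coordinates and back is the identity, so the M-coordinates of [A] are
   fixed by M *m M'^T *m (M' *m M^T). *)
Lemma lebesgue_row_chart_null M M' p A :
  M *m M^T = 1%:M -> M' *m M'^T = 1%:M -> measurable_rows A ->
  A `<=` range (flat_chart M p) -> A `<=` range (flat_chart M' p) ->
  M *m M'^T *m (M' *m M^T) != 1%:M ->
  lebesgue_row (flat_chart M p @^-1` A) = 0%E.
Proof.
move=> orthoM orthoM' mA AM AM'; rewrite -subr_eq0 => C_neq0.
apply: (lebesgue_row_sub_ker C_neq0); first exact: measurable_flat_chart.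
move=> u /= Au; have u'E := flat_chart_transition orthoM' (AM' _ Au).
have := Au; rewrite -u'E => /AM /(flat_chart_transition orthoM).
rewrite u'E => /(can_inj (flat_chartK p orthoM)) uE.
by rewrite mulmxBr mulmx1 [u *m _]mulmxA uE subrr.
Qed.

Lemma lebesgue_row_chart_same_base M M' p A :
  M *m M^T = 1%:M -> M' *m M'^T = 1%:M -> measurable_rows A ->
  A `<=` range (flat_chart M p) -> A `<=` range (flat_chart M' p) ->
  lebesgue_row (flat_chart M p @^-1` A) =
    lebesgue_row (flat_chart M' p @^-1` A).
Proof.
move=> orthoM orthoM' mA AM AM'; set C := M *m M'^T.
have trC : C^T = M' *m M^T by rewrite trmx_mul trmxK.
have [CC|C_neq] := eqVneq (C *m C^T) 1%:M; last first.
  rewrite (lebesgue_row_chart_null orthoM orthoM')// -/C -?trC//.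
  rewrite (lebesgue_row_chart_null orthoM' orthoM)// -/C -trC//.
  by apply: contra_neq C_neq; exact: mulmx1C.
have Cu : C \in unitmx by have [] := mulmx1_unit CC.
have detC : `|\det C| = 1.
  have : \det C ^+ 2 = 1 by rewrite expr2 -{2}det_tr -det_mulmx CC det1.
  by move=> /eqP; rewrite sqrf_eq1 => /orP[]/eqP->; rewrite ?normrN normr1.
rewrite -[RHS]mul1e -[1%E]/(1%:E) -[X in X%:E]invr1 -detC.
rewrite -(scales_volume_unitmx Cu (measurable_flat_chart M' p mA)).
congr lebesgue_row; apply/seteqP; split => u /= Au.
  by rewrite flat_chart_transition//; exact: AM'.
rewrite -[u]mulmx1 -CC mulmxA trC flat_chart_transition//; exact: AM.
Qed.

Lemma lebesgue_row_chart M M' b b' A :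
  M *m M^T = 1%:M -> M' *m M'^T = 1%:M -> measurable_rows A ->
  A `<=` range (flat_chart M b) -> A `<=` range (flat_chart M' b') ->
  lebesgue_row (flat_chart M b @^-1` A) =
    lebesgue_row (flat_chart M' b' @^-1` A).
Proof.
move=> orthoM orthoM' mA AM AM'; have [->|/set0P[p Ap]] := eqVneq A set0.
  by rewrite !preimage_set0 !lebesgue_row_set0.
have [Mp M'p] := (AM _ Ap, AM' _ Ap).
rewrite -(lebesgue_row_rebase mA Mp) -(lebesgue_row_rebase mA M'p).
apply: lebesgue_row_chart_same_base => //.
  exact: subset_trans (range_flat_chart_rebase Mp).
exact: subset_trans (range_flat_chart_rebase M'p).
Qed.

Lemma flat_volumeE M b A :
  M *m M^T = 1%:M -> measurable_rows A -> A `<=` range (flat_chart M b) ->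
  flat_volume d A = lebesgue_row (flat_chart M b @^-1` A).
Proof.
move=> orthoM mA AM; apply: xget_unique; first by exists M, b.
by move=> v [M' [b' [orthoM' AM' ->]]]; exact: lebesgue_row_chart.
Qed.

Lemma flat_volume_bounded_fin_num M b A C :
  M *m M^T = 1%:M -> measurable_rows A -> A `<=` range (flat_chart M b) ->
  (forall x, A x -> forall i, `|x 0 i| <= C) -> flat_volume d A \is a fin_num.
Proof.
move=> orthoM mA AM AC.
rewrite (flat_volumeE orthoM mA AM) ge0_fin_numE ?lebesgue_row_ge0//.
pose D := \sum_j \sum_i (C + `|b 0 i|) * `|M j i|.
apply: (@lebesgue_row_bounded_lty _ _ _ D); first exact: measurable_flat_chart.
move=> u /= Au j; rewrite -[u](flat_chartK b orthoM).
move: (flat_chart M b u) (AC _ Au) => x xC.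
have C_ge0 i : 0 <= C + `|b 0 i| by rewrite addr_ge0// (le_trans _ (xC i)).
rewrite mxE (le_trans (ler_norm_sum _ _ _))//.
rewrite /D (bigD1 j)//= ler_wpDr//.
  by apply: sumr_ge0 => l _; apply: sumr_ge0 => i _; rewrite mulr_ge0.
apply: ler_sum => i _; rewrite normrM !mxE ler_wpM2r//.
by rewrite (le_trans (ler_normB _ _))// lerD2r.
Qed.

End flat_charts.

Section orthonormal_frames.
Context {R : rcfType}.

Lemma exists_orthogonal_unit_row n m (N : 'M[R]_(n, m)) : (m < n)%N ->
  exists2 v : 'rV[R]_n, v *m v^T = 1%:M & v *m N = 0.
Proof.
move=> mn; have : kermx N != 0.
  by rewrite -mxrank_eq0 mxrank_ker subn_eq0 -ltnNge
    (leq_ltn_trans (rank_leq_col _)).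
move=> /rowV0Pn[v /sub_kermxP vN v0]; pose s := \sum_i v 0 i ^+ 2.
have s0 : 0 < s.
  rewrite lt_neqAle eq_sym sumr_ge0 => [|i _]; last exact: sqr_ge0.
  rewrite andbT; apply: contraNneq v0 => /eqP; rewrite psumr_eq0 => [|i _];
    last exact: sqr_ge0.
  move=> /allP v_eq0; apply/eqP/rowP => i; rewrite mxE; apply/eqP.
  by have := v_eq0 i (mem_index_enum i); rewrite sqrf_eq0.
have vv : v *m v^T = s%:M.
  by rewrite [LHS]mx11_scalar mxE; congr _%:M; apply: eq_bigr => i _;
    rewrite mxE expr2.
exists ((Num.sqrt s)^-1 *: v); last by rewrite -scalemxAl vN scaler0.
rewrite linearZ /= -scalemxAr -scalemxAl vv scalerA scale_scalar_mx.
by rewrite -invfM -expr2 sqr_sqrtr ?ltW// mulVf ?gt_eqF.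
Qed.

Lemma exists_orthonormal_ker d n m (N : 'M[R]_(n, m)) : (d + m <= n)%N ->
  exists2 M : 'M[R]_(d, n), M *m M^T = 1%:M & M *m N = 0.
Proof.
elim: d => [|d IH] dn; first by exists 0; rewrite mul0mx // [RHS]flatmx0.
have [M orthoM MN] := IH (ltnW dn).
have [|v vv] := exists_orthogonal_unit_row (row_mx N M^T);
  first by rewrite addnC.
rewrite mul_mx_row => /eqP; rewrite row_mx_eq0 => /andP[/eqP vN /eqP vM].
have Mv : M *m v^T = 0 by rewrite -[LHS]trmxK trmx_mul trmxK vM trmx0.
rewrite -[d.+1]/(1 + d)%N; exists (col_mx v M);
  last by rewrite mul_col_mx MN vN col_mx0.
by rewrite tr_col_mx mul_col_row orthoM vM Mv vv -scalar_mx_block.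
Qed.

End orthonormal_frames.

(** * Faces of generalized permutahedra *)

Section fibers.
Context {n k : nat}.
Implicit Types (blk : 'I_n -> 'I_k) (I : {set 'I_n}).

Definition fiber blk (s : 'I_k) : {set 'I_n} := [set i | blk i == s]%SET.

Lemma in_fiber blk s i : (i \in fiber blk s) = (blk i == s).
Proof. by rewrite inE. Qed.

Lemma in_first_blocks blk r i :
  (i \in first_blocks (fiber blk) r) = (blk i < r)%N.
Proof.
apply/bigcupP/idP => [[s sr]|ir]; first by rewrite in_fiber => /eqP ->.
by exists (blk i); rewrite ?in_fiber.
Qed.

Lemma first_blocks0 blk : first_blocks (fiber blk) 0 = finset.set0.
Proof. by apply/setP => i; rewrite in_first_blocks inE. Qed.

Lemma first_blocks_all blk : first_blocks (fiber blk) k = [set: 'I_n]%SET.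
Proof. by apply/setP => i; rewrite in_first_blocks inE ltn_ord. Qed.

Lemma first_blocksS blk (s : 'I_k) : first_blocks (fiber blk) s.+1 =
  (fiber blk s :|: first_blocks (fiber blk) s)%SET.
Proof.
apply/setP => i; rewrite !inE !in_first_blocks ltnS -val_eqE /=.
by case: ltngtP.
Qed.

Lemma ordered_partition_fiber (pi : 'I_k -> {set 'I_n}) :
  ordered_partition pi ->
  exists2 blk, (forall s, exists i, blk i = s) & pi = fiber blk.
Proof.
move=> [pi_inj /and3P[/eqP covT trivP P0]].
have pi_imset s : pi s \in [set pi s | s : 'I_k]%SET by exact: imset_f.
have block_unique i s t : i \in pi s -> i \in pi t -> s = t.
  move=> i_s i_t; apply: pi_inj.
  by rewrite -(def_pblock trivP (pi_imset s) i_s)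
    (def_pblock trivP (pi_imset t) i_t).
have block_exists i : exists s, i \in pi s.
  have : i \in finset.cover [set pi s | s : 'I_k]%SET by rewrite covT inE.
  by move=> /bigcupP[_ /imsetP[s _ ->] ?]; exists s.
have [blk blkP] := choice block_exists.
exists blk => [s|].
  have /set0Pn[i i_s] : pi s != finset.set0 by apply: contraNneq P0 => <-.
  by exists i; exact: block_unique i_s.
apply/funext => s; apply/setP => i; rewrite in_fiber; apply/idP/eqP => [|<-//].
exact: block_unique.
Qed.

Lemma sum_first_blocksS (V : nmodType) blk (F : 'I_n -> V) I (s : 'I_k) :
  \sum_(i in (I :&: first_blocks (fiber blk) s.+1)%SET) F i =
  \sum_(i in (I :&: first_blocks (fiber blk) s)%SET) F i +
  \sum_(i in (I :&: fiber blk s)%SET) F i.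
Proof.
rewrite (big_setID (first_blocks (fiber blk) s)).
congr +%R; apply: eq_bigl => i; rewrite !inE !in_first_blocks ltnS -?val_eqE /=;
  by case: ltngtP => _; rewrite ?andbF ?andbT.
Qed.

End fibers.

Section supermodular_functions.
Context {R : realType} {n k : nat}.
Implicit Types (z : {set 'I_n} -> R) (pi : 'I_k -> {set 'I_n}) (I : {set 'I_n}).

(* The faces of type [pi] are products over [s] of the generalized permutahedra
   with parameters [block_minor z pi s] on [pi s]. *)
Definition block_minor z pi (s : 'I_k) I : R :=
  z ((I :&: pi s) :|: first_blocks pi s)%SET - z (first_blocks pi s).

Lemma block_minor_set0 z pi s : block_minor z pi s finset.set0 = 0.
Proof. by rewrite /block_minor finset.set0I finset.set0U subrr. Qed.

Lemma block_minorI z pi s I :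
  block_minor z pi s (I :&: pi s)%SET = block_minor z pi s I.
Proof. by rewrite /block_minor -finset.setIA finset.setIid. Qed.

Lemma supermodular_block_minor z pi s :
  supermodular z -> supermodular (block_minor z pi s).
Proof.
move=> z_super I J; rewrite /block_minor addrACA [leRHS]addrACA lerD2r.
have := z_super (I :&: pi s :|: first_blocks pi s)%SET
  (J :&: pi s :|: first_blocks pi s)%SET.
by rewrite -finset.setUIl finset.setUACA finset.setUid -finset.setIUl
  -finset.setIIl.
Qed.

Definition tight_face z pi : set 'rV[R]_n :=
  [set t | polytope_of z t /\ forall r, (r <= k)%N ->
     \sum_(i in first_blocks pi r) t 0 i = z (first_blocks pi r)].

End supermodular_functions.

Section tight_faces.
Context {R : realType} {n k : nat}.
Variables (z : {set 'I_n} -> R) (blk : 'I_n -> 'I_k).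
Hypotheses (z0 : z finset.set0 = 0) (z_super : supermodular z).
Local Notation pi := (fiber blk).

Section block_inequalities.
Variable t : 'rV[R]_n.
Hypothesis sum_fiber : forall s, \sum_(i in pi s) t 0 i = block_height z pi s.
Hypothesis sum_ge_minor :
  forall s I, block_minor z pi s I <= \sum_(i in (I :&: pi s)%SET) t 0 i.

Let sum_first_blocks r : (r <= k)%N ->
  \sum_(i in first_blocks pi r) t 0 i = z (first_blocks pi r).
Proof.
elim: r => [_|r IH rk]; first by rewrite first_blocks0 z0 big_set0.
have := sum_first_blocksS blk (t 0) [set: 'I_n]%SET (Ordinal rk).
rewrite !finset.setTI => ->; rewrite IH 1?ltnW// sum_fiber.
by rewrite /block_height addrC subrK.
Qed.

Let sum_ge_first_blocks I r : (r <= k)%N ->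
  z (I :&: first_blocks pi r)%SET <=
    \sum_(i in (I :&: first_blocks pi r)%SET) t 0 i.
Proof.
elim: r => [_|r IH rk]; first by rewrite first_blocks0 finset.setI0 z0 big_set0.
set s := Ordinal rk; rewrite -[r.+1]/s.+1 sum_first_blocksS.
have := z_super (I :&: first_blocks pi s.+1)%SET (first_blocks pi s).
have -> : (I :&: first_blocks pi s.+1 :|: first_blocks pi s)%SET =
    (I :&: pi s :|: first_blocks pi s)%SET.
  rewrite first_blocksS finset.setIUr -finset.setUA; congr (_ :|: _)%SET.
  exact/finset.setUidPr/finset.subsetIr.
have -> : (I :&: first_blocks pi s.+1 :&: first_blocks pi s)%SET =
    (I :&: first_blocks pi s)%SET.
  rewrite first_blocksS -finset.setIA; congr (_ :&: _)%SET.
  exact/finset.setIidPr/finset.subsetUr.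
have := IH (ltnW rk); have := sum_ge_minor s I; rewrite /block_minor /=.
lra.
Qed.

Lemma tight_face_block_inequalities : tight_face z pi t.
Proof.
split=> //; split=> [|I].
  rewrite -(first_blocks_all blk) -sum_first_blocks//.
  by apply: eq_bigl => i; rewrite in_first_blocks ltn_ord.
by have := sum_ge_first_blocks I (leqnn k);
  rewrite first_blocks_all finset.setIT.
Qed.

End block_inequalities.

Lemma tight_faceP t : tight_face z pi t <->
  (forall s, \sum_(i in pi s) t 0 i = block_height z pi s) /\
  (forall s I, block_minor z pi s I <= \sum_(i in (I :&: pi s)%SET) t 0 i).
Proof.
split=> [[[_ t_ge] tight]|[t_eq t_ge]];
  last exact: tight_face_block_inequalities.
split=> s.
  have := sum_first_blocksS blk (t 0) [set: 'I_n]%SET s.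
  rewrite !finset.setTI !tight//; last exact: ltnW.
  by rewrite /block_height => ->; rewrite addrC addKr.
move=> I; rewrite /block_minor lerBlDr -tight 1?ltnW//.
have -> : \sum_(i in (I :&: pi s)%SET) t 0 i +
    \sum_(i in first_blocks pi s) t 0 i =
    \sum_(i in (I :&: pi s :|: first_blocks pi s)%SET) t 0 i; last exact: t_ge.
rewrite [RHS](big_setID (first_blocks pi s)) addrC /=.
congr +%R; apply: eq_bigl => i; rewrite !inE !in_first_blocks -val_eqE /=;
  by case: ltngtP; rewrite ?andbF ?andbT ?orbF ?orbT.
Qed.

End tight_faces.

Lemma polytope_of_neq0 (R : realType) n (z : {set 'I_n} -> R) :
  z finset.set0 = 0 -> supermodular z -> polytope_of z !=set0.
Proof.
move=> z0 z_super; exists (\row_i block_height z (fiber id) i).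
have fiber_id s : fiber id s = [set s]%SET by apply/setP => i; rewrite !inE.
suff [] : tight_face z (fiber id) (\row_i block_height z (fiber id) i) by [].
apply/tight_faceP => //; split=> [s|s I];
  first by rewrite fiber_id big_set1 mxE.
have [sI|sI] := boolP (s \in I).
  have Is : (I :&: [set s])%SET = [set s]%SET.
    by apply/finset.setIidPr; rewrite finset.sub1set.
  rewrite /block_minor fiber_id Is big_set1 mxE.
  by rewrite /block_height first_blocksS fiber_id.
have Is : (I :&: [set s])%SET = finset.set0.
  by apply/setP => i; rewrite !inE; case: eqP => [->|];
    rewrite ?(negbTE sI) ?andbF.
by rewrite -block_minorI fiber_id Is block_minor_set0 big_set0.
Qed.

Lemma polytope_of_bounded (R : realType) n (z : {set 'I_n} -> R) :
  exists C, forall t, polytope_of z t -> forall i, `|t 0 i| <= C.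
Proof.
have norm_le I : `|z I| <= \sum_J `|z J| by rewrite (bigD1 I)//= lerDl sumr_ge0.
exists (\sum_I `|z I| + \sum_I `|z I|) => t [t_sum t_ge] i.
have lower : z [set i]%SET <= t 0 i.
  by have := t_ge [set i]%SET; rewrite big_set1.
have upper : t 0 i + z [set~ i]%SET <= z [set: 'I_n]%SET.
  rewrite -t_sum [leRHS](bigD1 i)//= lerD2l; have := t_ge [set~ i]%SET.
  by congr (_ <= _); apply: eq_bigl => j; rewrite !inE.
have := norm_le [set i]%SET; have := norm_le [set~ i]%SET.
have := norm_le [set: 'I_n]%SET; rewrite !ler_norml.
by move=> /andP[? ?] /andP[? _] /andP[? _]; apply/andP; split; lra.
Qed.

Section faces.
Context {R : realType} {n k : nat}.
Variables (z : {set 'I_n} -> R) (blk : 'I_n -> 'I_k).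
Hypotheses (z0 : z finset.set0 = 0) (z_super : supermodular z).
Hypothesis blk_surj : forall s, exists i, blk i = s.
Local Notation pi := (fiber blk).

Lemma block_minor_setT s :
  block_minor z pi s [set: 'I_n]%SET = block_height z pi s.
Proof. by rewrite /block_minor /block_height finset.setTI first_blocksS. Qed.

Lemma tight_face_neq0 : tight_face z pi !=set0.
Proof.
have [g gP] := choice (fun s => polytope_of_neq0
  (block_minor_set0 z pi s) (supermodular_block_minor pi s z_super)).
have sum_fiber s : \sum_(i in pi s) g s 0 i = block_height z pi s.
  have [g_sum g_ge] := gP s; apply/le_anti/andP; split; last first.
    by have := g_ge (pi s);
      rewrite -[pi s]finset.setTI block_minorI block_minor_setT.
  rewrite -block_minor_setT -g_sum [leRHS](bigID (mem (pi s)))/=.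
  rewrite lerDl sumr_ge0// => i i_s.
  have := g_ge [set i]%SET; rewrite big_set1; congr (_ <= _).
  rewrite -block_minorI -(block_minor_set0 z pi s); congr block_minor.
  by apply/setP => j; rewrite !inE; case: eqP => [->|]//;
    rewrite -in_fiber (negbTE i_s).
exists (\row_i g (blk i) 0 i); apply/tight_faceP => //.
have blockwise s I : \sum_(i in (I :&: pi s)%SET) (\row_i g (blk i) 0 i) 0 i =
    \sum_(i in (I :&: pi s)%SET) g s 0 i.
  by apply: eq_bigr => i; rewrite !inE mxE => /andP[_ /eqP ->].
split=> [s|s I]; first by rewrite -[pi s]finset.setTI blockwise finset.setTI.
by rewrite blockwise -block_minorI; exact: (gP s).2.
Qed.

Lemma block_height_gt0 s :
  (forall t, polytope_of z t -> forall i, 0 < t 0 i) -> 0 < block_height z pi s.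
Proof.
move=> P_pos; have [i bi] := blk_surj s; have [x Fx] := tight_face_neq0.
have [<- _] := (tight_faceP blk z0 z_super x).1 Fx.
rewrite (bigD1 i) ?in_fiber ?bi//= ltr_pwDl ?P_pos//; first exact: Fx.1.
by apply: sumr_ge0 => j _; rewrite ltW// P_pos//; exact: Fx.1.
Qed.

Lemma has_type_fiber (a : 'rV[R]_n) : has_type pi a ->
  exists2 al : nat -> R, (forall i, a 0 i = al (blk i)) &
    forall r, (r.+1 < k)%N -> al r < al r.+1.
Proof.
move=> [a_eq a_lt]; have [f fK] := choice blk_surj.
pose al r := if insub r is Some s then a 0 (f s) else 0.
have alE s : al (val s) = a 0 (f s) by rewrite /al valK.
exists al => [i|r rk].
  by rewrite alE; apply/a_eq; exists (blk i); rewrite !in_fiber fK eqxx.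
rewrite (alE (Ordinal (ltnW rk))) (alE (Ordinal rk)).
by apply: (a_lt (Ordinal (ltnW rk)) (Ordinal rk)); rewrite ?in_fiber ?fK.
Qed.

Lemma dotv_first_blocks (a t : 'rV[R]_n) (al : nat -> R) :
  (forall i, a 0 i = al (blk i)) ->
  dotv a t = al k.-1 * \sum_i t 0 i -
    \sum_(r < k.-1) (al r.+1 - al r) * \sum_(i in first_blocks pi r.+1) t 0 i.
Proof.
move=> aE; have alE i : al (blk i) =
    al k.-1 - \sum_(r < k.-1 | (blk i <= r)%N) (al r.+1 - al r).
  have blk_le : (blk i <= k.-1)%N.
    by rewrite -ltnS prednK// (leq_ltn_trans _ (ltn_ord (blk i))).
  have := big_geq_mkord (blk i) k.-1 xpredT (fun r => al r.+1 - al r) => /= <-.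
  by rewrite telescope_sumr// opprB addrC subrK.
rewrite /dotv; under eq_bigr do rewrite aE alE mulrBl.
rewrite sumrB mulr_sumr; congr (_ - _).
under eq_bigr do rewrite mulr_suml.
rewrite (exchange_big_dep xpredT)//=; apply: eq_bigr => r _.
by rewrite mulr_sumr; apply: eq_bigl => i; rewrite in_first_blocks ltnS.
Qed.

Lemma max_face_tight_face (a : 'rV[R]_n) :
  has_type pi a -> max_face (polytope_of z) a = tight_face z pi.
Proof.
move=> /has_type_fiber[al aE al_lt].
pose excess (t : 'rV[R]_n) r :=
  \sum_(i in first_blocks pi r) t 0 i - z (first_blocks pi r).
have rk (r : 'I_k.-1) : (r.+1 < k)%N by rewrite -ltn_predRL.
have term_ge0 t (r : 'I_k.-1) : polytope_of z t ->
    0 <= (al r.+1 - al r) * excess t r.+1.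
  by move=> [_ t_ge]; rewrite mulr_ge0 ?subr_ge0// ltW// al_lt.
pose C := al k.-1 * z [set: 'I_n]%SET -
  \sum_(r < k.-1) (al r.+1 - al r) * z (first_blocks pi r.+1).
have dotvE t : polytope_of z t ->
    dotv a t = C - \sum_(r < k.-1) (al r.+1 - al r) * excess t r.+1.
  move=> [t_sum _].
  rewrite (dotv_first_blocks t aE) t_sum /C -addrA -opprD -big_split.
  by congr (_ - _); apply: eq_bigr => r _; rewrite /excess /=; ring.
have dotv_tight t : tight_face z pi t -> dotv a t = C.
  move=> [Pt tight]; rewrite dotvE// big1 ?subr0// => r _.
  by rewrite /excess tight ?subrr ?mulr0// ltnW.
apply/seteqP; split => t.
  move=> [Pt t_max]; split=> // r r_le; have [g Fg] := tight_face_neq0.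
  have := t_max g Fg.1; rewrite dotv_tight// dotvE// lerDl oppr_ge0 => sum_le0.
  have /eqP : \sum_(r < k.-1) (al r.+1 - al r) * excess t r.+1 = 0.
    by apply/le_anti; rewrite sum_le0 sumr_ge0// => s _; exact: term_ge0.
  rewrite psumr_eq0 => [/allP terms_eq0|s _]; last exact: term_ge0.
  case: r r_le => [_|r]; first by rewrite first_blocks0 z0 big_set0.
  rewrite leq_eqVlt => /predU1P[rk1|r_lt].
    by rewrite rk1 first_blocks_all -Pt.1; apply: eq_bigl => i; rewrite inE.
  have r_lt' : (r < k.-1)%N by rewrite ltn_predRL.
  have := terms_eq0 (Ordinal r_lt') (mem_index_enum _).
  by rewrite mulf_eq0 subr_eq0 gt_eqF ?al_lt//= /excess subr_eq0 => /eqP.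
move=> Ft; split=> [|y Py]; first exact: Ft.1.
rewrite (dotv_tight t Ft) dotvE// gerBl.
by apply: sumr_ge0 => r _; exact: term_ge0.
Qed.

End faces.

(** * The lifting as a polyhedron *)

Section convex_combinations.
Context {R : realFieldType} {M : lmodType R}.
Implicit Type A : set (convex_lmodType M).

Lemma convex_setP A : convex_set A <->
  (forall x y (l : R), 0 <= l <= 1 -> A x -> A y -> A (l *: x + (1 - l) *: y)).
Proof.
split=> [cA x y l /andP[l0 l1] Ax Ay|cA x y l].
  by have := cA x y (Itv01 l0 l1); rewrite !inE; apply.
by rewrite !inE => Ax Ay; apply: (cA x y l%:inum) => //; apply/andP; split.
Qed.

Lemma convex_set_sum A m (l : 'I_m -> R) (x : 'I_m -> M) : convex_set A ->
  (forall i, 0 <= l i) -> (forall i, A (x i)) -> \sum_i l i = 1 ->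
  A (\sum_i l i *: x i).
Proof.
move=> /convex_setP cA; elim: m l x => [|m IH] l x l_ge0 Ax.
  by rewrite big_ord0 => /esym/eqP; rewrite oner_eq0.
rewrite !big_ord_recr /=; set S := \sum_(i < m) _ => l1.
have S_ge0 : 0 <= S by exact: sumr_ge0.
have l_last : l ord_max = 1 - S by move: l1; lra.
have [S0|S0] := eqVneq S 0.
  rewrite big1 => [|i _]; first by rewrite l_last S0 subr0 scale1r add0r.
  have /eqP := S0; rewrite psumr_eq0// => /allP/(_ i (mem_index_enum i))/eqP ->.
  by rewrite scale0r.
pose w := widen_ord (leqnSn m).
have -> : \sum_(i < m) l (w i) *: x (w i) =
    S *: \sum_(i < m) (l (w i) / S) *: x (w i).
  by rewrite scaler_sumr; apply: eq_bigr => i _; rewrite scalerA mulrC divfK.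
rewrite l_last; apply: cA => //; first by rewrite S_ge0 -subr_ge0 -l_last l_ge0.
by apply: IH => [i||]; rewrite ?divr_ge0// -mulr_suml mulfV.
Qed.

End convex_combinations.

Section monotone_factors.
Context {R : realFieldType} {k : nat}.

Definition monotone_factors (q u : R) : set ('I_k -> R) :=
  [set rho | (forall s, q <= rho s <= u) /\
             forall s t : 'I_k, (s <= t)%N -> rho s <= rho t].

Definition threshold_factors (q : R) (r : nat) (s : 'I_k) : R :=
  if (s < r)%N then q else 1.

Lemma threshold_factors_monotone q r :
  q <= 1 -> monotone_factors q 1 (threshold_factors q r).
Proof.
move=> q1; split=> [s|s t st]; rewrite /threshold_factors.
  by case: ifP; rewrite lexx q1.
by case: ifPn => sr; case: ifPn => // /(leq_ltn_trans st) /(negP sr).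
Qed.

(* The weight of the r-th threshold is the relative jump of
   q <= rho_0 <= ... <= rho_(k-1) <= 1 at its r-th step. *)
Lemma monotone_factors_convex_combination q rho :
  q < 1 -> monotone_factors q 1 rho ->
  exists l : 'I_k.+1 -> R, [/\ forall r, 0 <= l r, \sum_r l r = 1 &
    forall s, \sum_r l r * threshold_factors q r s = rho s].
Proof.
move=> q1 [rho_itv rho_mono].
pose ext r :=
  if r is r'.+1 then (if insub r' is Some s then rho s else 1) else q.
have extS (s : 'I_k) : ext s.+1 = rho s by rewrite /ext valK.
have ext_last r : (k <= r)%N -> ext r.+1 = 1.
  by move=> kr; rewrite /ext insubF// ltnNge kr.
have q0 : 1 - q != 0 by rewrite subr_eq0 gt_eqF.
have ext_le1 r : ext r <= 1.
  case: r => [|r] /=; first exact: ltW.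
  by case: insubP => // s _ _; case/andP: (rho_itv s).
have ext_incr r : ext r <= ext r.+1.
  have [rk|kr] := ltnP r k; last by rewrite ext_last.
  rewrite (extS (Ordinal rk)); case: r rk => [|r] rk;
    first by case/andP: (rho_itv (Ordinal rk)).
  by rewrite (extS (Ordinal (ltnW rk))) rho_mono.
have sum_jumps m : \sum_(r < m) (ext r.+1 - ext r) = ext m - q.
  by rewrite -(big_mkord xpredT (fun r => ext r.+1 - ext r)) telescope_sumr.
have weights1 : \sum_(r < k.+1) (ext r.+1 - ext r) / (1 - q) = 1.
  by rewrite -mulr_suml sum_jumps ext_last// mulfV.
exists (fun r => (ext r.+1 - ext r) / (1 - q)); split=> // [r|s].
  by rewrite divr_ge0 ?subr_ge0// ltW.
transitivity (q * \sum_(r < k.+1) (ext r.+1 - ext r) / (1 - q) +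
    \sum_(r < k.+1 | (r < s.+1)%N) (ext r.+1 - ext r)).
  rewrite mulr_sumr [X in _ = _ + X]big_mkcond -big_split;
    apply: eq_bigr => r _ /=.
  by rewrite /threshold_factors ltnS; case: ltnP => _; field.
rewrite weights1 mulr1 -(big_ord_widen _ (fun r => ext r.+1 - ext r)).
  by rewrite sum_jumps extS addrC subrK.
by rewrite ltnS ltnW.
Qed.

End monotone_factors.

Section block_scaling.
Context {R : realType} {n k : nat}.
Variables (z : {set 'I_n} -> R) (blk : 'I_n -> 'I_k).
Local Notation pi := (fiber blk).
Implicit Types (rho : 'I_k -> R) (x y : 'rV[R]_n).

Definition scale_blocks rho x : 'rV[R]_n := \row_i (rho (blk i) * x 0 i).

Lemma sum_scale_blocks rho x s (I : {set 'I_n}) : I \subset pi s ->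
  \sum_(i in I) scale_blocks rho x 0 i = rho s * \sum_(i in I) x 0 i.
Proof.
move=> /fintype.subsetP I_s; rewrite mulr_sumr; apply: eq_bigr => i /I_s.
by rewrite in_fiber mxE => /eqP ->.
Qed.

Lemma scale_coords_first_blocks q r x :
  scale_coords q (first_blocks pi r) x = scale_blocks (threshold_factors q r) x.
Proof.
apply/rowP => i; rewrite !mxE in_first_blocks /threshold_factors.
by case: ifP => // _; rewrite mul1r.
Qed.

Definition block_ratio (s : 'I_k) y : R :=
  (\sum_(i in pi s) y 0 i) / block_height z pi s.

Definition lifting_polyhedron (q : R) : set 'rV[R]_n :=
  [set y | monotone_factors q 1 (block_ratio^~ y) /\
    forall s (I : {set 'I_n}), block_ratio s y * block_minor z pi s I <=
      \sum_(i in (I :&: pi s)%SET) y 0 i].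

Lemma lifting_polyhedron_convex q :
  convex_set (lifting_polyhedron q : set (convex_lmodType 'rV[R]_n)).
Proof.
apply/convex_setP => x y l /andP[l0 l1].
move=> [[x_itv x_mono] x_ge] [[y_itv y_mono] y_ge].
have l1' : 0 <= 1 - l by rewrite subr_ge0.
have sum_conv (I : {set 'I_n}) : \sum_(i in I) (l *: x + (1 - l) *: y) 0 i =
    l * (\sum_(i in I) x 0 i) + (1 - l) * \sum_(i in I) y 0 i.
  by rewrite !mulr_sumr -big_split; apply: eq_bigr => i _; rewrite !mxE.
have ratio_conv s : block_ratio s (l *: x + (1 - l) *: y) =
    l * block_ratio s x + (1 - l) * block_ratio s y.
  by rewrite /block_ratio sum_conv mulrDl !mulrA.
split=> [|s I]; last first.
  rewrite ratio_conv sum_conv mulrDl -(mulrA l) -(mulrA (1 - l)).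
  by apply: lerD; apply: ler_wpM2l.
split=> [s|s t st]; rewrite !ratio_conv; last first.
  by apply: lerD; apply: ler_wpM2l => //; [exact: x_mono|exact: y_mono].
have /andP[? ?] := x_itv s; have /andP[? ?] := y_itv s.
have conv_id (c : R) : c = l * c + (1 - l) * c by ring.
by apply/andP; split; [rewrite [leLHS]conv_id|rewrite [leRHS]conv_id];
  rewrite lerD// ler_wpM2l.
Qed.

Hypotheses (z0 : z finset.set0 = 0) (z_super : supermodular z).
Hypothesis height_gt0 : forall s, 0 < block_height z pi s.

Lemma block_ratioK s y :
  \sum_(i in pi s) y 0 i = block_ratio s y * block_height z pi s.
Proof. by rewrite /block_ratio divfK// gt_eqF. Qed.

Lemma block_ratio_scale_blocks rho x s :
  tight_face z pi x -> block_ratio s (scale_blocks rho x) = rho s.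
Proof.
move=> /(tight_faceP _ z0 z_super)[sum_fiber _].
rewrite /block_ratio (sum_scale_blocks rho x (fintype.subxx (pi s))).
by rewrite sum_fiber mulfK// gt_eqF.
Qed.

Lemma scale_blocks_lifting_polyhedron q rho x : 0 <= q -> tight_face z pi x ->
  monotone_factors q 1 rho -> lifting_polyhedron q (scale_blocks rho x).
Proof.
move=> q0 Fx [rho_itv rho_mono].
have ratioE s : block_ratio s (scale_blocks rho x) = rho s.
  exact: block_ratio_scale_blocks.
split=> [|s I]; first by split=> [s|s t st]; rewrite !ratioE//; exact: rho_mono.
have [_ x_ge] := (tight_faceP blk z0 z_super x).1 Fx.
rewrite ratioE (sum_scale_blocks rho x (finset.subsetIr I (pi s))) ler_wpM2l//.
by have /andP[/(le_trans q0)] := rho_itv s.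
Qed.

Lemma lifting_polyhedron_ratio0 q y i : lifting_polyhedron q y ->
  block_ratio (blk i) y = 0 -> y 0 i = 0.
Proof.
move=> [_ y_ge] ratio0; have y_ge0 j : j \in pi (blk i) -> 0 <= y 0 j.
  move=> ij; have := y_ge (blk i) [set j]%SET; rewrite ratio0 mul0r.
  by rewrite (_ : (_ :&: _)%SET = [set j]%SET) ?big_set1//;
    apply/finset.setIidPl; rewrite finset.sub1set.
have /eqP := block_ratioK (blk i) y; rewrite ratio0 mul0r psumr_eq0//.
by move=> /allP/(_ i (mem_index_enum i)); rewrite in_fiber eqxx => /eqP.
Qed.

Lemma lifting_polyhedron_scale_blocks q y : 0 <= q -> lifting_polyhedron q y ->
  exists2 x, tight_face z pi x & y = scale_blocks (block_ratio^~ y) x.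
Proof.
move=> q0 Ly; have [[ratio_itv _] y_ge] := Ly.
have ratio_ge0 s : 0 <= block_ratio s y.
  by have /andP[/(le_trans q0)] := ratio_itv s.
have [g /(tight_faceP _ z0 z_super)[g_sum g_ge]] :=
  tight_face_neq0 blk z0 z_super.
pose x : 'rV[R]_n := \row_i (if block_ratio (blk i) y == 0 then g 0 i
                             else y 0 i / block_ratio (blk i) y).
have sum_x s (I : {set 'I_n}) : I \subset pi s -> \sum_(i in I) x 0 i =
    if block_ratio s y == 0 then \sum_(i in I) g 0 i
    else (\sum_(i in I) y 0 i) / block_ratio s y.
  move=> /fintype.subsetP I_s; case: ifP => r0; rewrite ?mulr_suml;
    by apply: eq_bigr => i /I_s; rewrite in_fiber mxE => /eqP ->; rewrite r0.
exists x; last first.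
  apply/rowP => i; rewrite !mxE; case: eqVneq => [r0|r0];
    last by rewrite mulrC divfK.
  by rewrite r0 mul0r (lifting_polyhedron_ratio0 Ly).
apply/(tight_faceP _ z0 z_super); split=> [s|s I].
  by rewrite (sum_x s)//; case: eqVneq => // r0;
    rewrite block_ratioK mulrC mulKf.
rewrite (sum_x s) ?finset.subsetIr//; case: eqVneq => // r0.
by rewrite ler_pdivlMr ?lt_neqAle 1?eq_sym ?r0 ?ratio_ge0// mulrC.
Qed.

Lemma lifting_tight_face q : 0 <= q <= 1 ->
  lifting pi q (tight_face z pi) = lifting_polyhedron q.
Proof.
move=> /andP[q0 q1]; apply/seteqP; split.
  apply: smallest_sub; first exact: lifting_polyhedron_convex.
  move=> _ [r _ [x Fx <-]]; rewrite scale_coords_first_blocks.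
  by apply: scale_blocks_lifting_polyhedron => //;
    exact: threshold_factors_monotone.
move=> y Ly C [C_convex sub_C].
have [x Fx ->] := lifting_polyhedron_scale_blocks q0 Ly.
have Cx (r : 'I_k.+1) : C (scale_blocks (threshold_factors q r) x).
  apply: sub_C; exists (r : nat); first by rewrite /= -ltnS.
  by exists x => //; rewrite scale_coords_first_blocks.
have [q_eq1|q_neq1] := eqVneq q 1.
  have := Cx ord0; congr C; apply/rowP => i; rewrite !mxE /threshold_factors /=.
  by have := Ly.1.1 (blk i); rewrite q_eq1 => /le_anti ->.
have q_lt1 : q < 1 by rewrite lt_neqAle q_neq1.
have [l [l_ge0 l1 lE]] := monotone_factors_convex_combination q_lt1 Ly.1.
have := convex_set_sum C_convex l_ge0 Cx l1.
congr C; apply/rowP => i; rewrite summxE [RHS]mxE -lE mulr_suml.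
by apply: eq_bigr => r _; rewrite !mxE mulrA.
Qed.

End block_scaling.

Section measurability.
Context {R : realType} {n k : nat}.
Variables (z : {set 'I_n} -> R) (blk : 'I_n -> 'I_k).
Local Notation pi := (fiber blk).

Let measurable_sum_coords (I : {set 'I_n}) :
  measurable_row_fun (fun x : 'rV[R]_n => \sum_(i in I) x 0 i).
Proof.
by apply: measurable_row_fun_sum => i; exact: measurable_row_fun_coord.
Qed.

Let measurable_const (c : R) : measurable_row_fun (fun _ : 'rV[R]_n => c).
Proof. exact: measurable_row_fun_cst. Qed.

Let measurable_block_ratio s : measurable_row_fun (block_ratio z blk s).
Proof. by apply: measurable_row_funM. Qed.

Lemma measurable_polytope_of : measurable_rows (polytope_of z).
Proof.
apply: measurable_rowsI.
  apply: measurable_rows_eq => //; apply: measurable_row_fun_sum => i.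
  exact: measurable_row_fun_coord.
by apply: measurable_rows_forall => I; exact: measurable_rows_le.
Qed.

Lemma measurable_tight_face : measurable_rows (tight_face z pi).
Proof.
apply: measurable_rowsI; first exact: measurable_polytope_of.
have := measurable_rows_forall (fun r : 'I_k.+1 => measurable_rows_eq
  (measurable_sum_coords (first_blocks pi r))
  (measurable_const (z (first_blocks pi r)))).
congr measurable_rows; apply/seteqP; split => x /= tight r;
  last by apply: tight; rewrite -ltnS.
by move=> rk; have := tight (Ordinal (rk : r < k.+1)%N).
Qed.

Lemma measurable_lifting_polyhedron q :
  measurable_rows (lifting_polyhedron z blk q).
Proof.
apply: measurable_rowsI; last first.
  apply: measurable_rows_forall => s; apply: measurable_rows_forall => I.
  by apply: measurable_rows_le => //; apply: measurable_row_funM.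
apply: measurable_rowsI.
  apply: measurable_rows_forall => s.
  have := measurable_rowsI
    (measurable_rows_le (measurable_const q) (measurable_block_ratio s))
    (measurable_rows_le (measurable_block_ratio s) (measurable_const 1)).
  congr measurable_rows; apply/seteqP; split => x /=; first by move=> [-> ->].
  by move=> /andP.
apply: measurable_rows_forall => s; apply: measurable_rows_forall => t.
by apply: measurable_rows_imply; exact: measurable_rows_le.
Qed.

End measurability.

(** * Iterated integrals *)

Section primitives.

Definition primitive (A : unitRingType) (p : {poly A}) : {poly A} :=
  \poly_(i < (size p).+1) (p`_i.-1 / i%:R).

Lemma coef_primitive (A : unitRingType) (p : {poly A}) i :
  (primitive p)`_i = p`_i.-1 / i%:R.
Proof.
rewrite coef_poly ltnS; case: leqP => // size_lt.
by case: i size_lt => // i; rewrite ltnS => size_le; rewrite nth_default ?mul0r.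
Qed.

Lemma deriv_primitive (F : numFieldType) (p : {poly F}) : (primitive p)^`() = p.
Proof.
apply/polyP => i.
by rewrite coef_deriv coef_primitive /= -[LHS]mulr_natr divfK ?pnatr_eq0.
Qed.

Lemma map_primitive_horner_eval (F : fieldType) (Q : {poly {poly F}}) (q : F) :
  map_poly (horner_eval q) (primitive Q) =
    primitive (map_poly (horner_eval q) Q).
Proof.
apply/polyP => i; rewrite coef_map !coef_primitive coef_map /=.
by rewrite !horner_evalE hornerM -polyC_natr polyCV hornerC.
Qed.

Lemma horner2_map_poly (A : comNzRingType) (Q : {poly {poly A}}) (t q : A) :
  Q.[t, q] = (map_poly (horner_eval q) Q).[t].
Proof. by rewrite -[in RHS](hornerC t q) (horner_map (horner_eval q)). Qed.

End primitives.

Section iterated_integrals.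
Context {R : realType}.
Local Notation mu := (@lebesgue_measure R).
Implicit Types (p : {poly R}) (Q : {poly {poly R}}) (q u : R) (c : seq nat).

Lemma integral_horner p q u : q <= u ->
  (\int[mu]_(t in `[q, u]) p.[t])%R = (primitive p).[u] - (primitive p).[q].
Proof.
rewrite le_eqVlt => /predU1P[<-|qu];
  first by rewrite set_itv1 Rintegral_set1 subrr.
rewrite /Rintegral (@continuous_FTC2 _ _ (horner (primitive p)))//.
- by apply: continuous_in_subspaceT => x _; exact: continuous_horner.
- split => [x _||]; first exact: derivable_horner.
  + by apply: cvg_at_right_filter; exact: continuous_horner.
  + by apply: cvg_at_left_filter; exact: continuous_horner.
- by move=> x _; rewrite -derivE deriv_primitive.
Qed.

(* The inner variable is the lower bound of the integral, the outer one its
   upper bound. *)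
Definition integral_poly Q : {poly {poly R}} :=
  primitive Q - ((primitive Q).['X])%:P.

Lemma integral_polyE Q q u : q <= u ->
  (\int[mu]_(t in `[q, u]) Q.[t, q])%R = (integral_poly Q).[u, q].
Proof.
move=> qu.
transitivity (\int[mu]_(t in `[q, u]) (map_poly (horner_eval q) Q).[t])%R.
  by apply: eq_Rintegral => t _; exact: horner2_map_poly.
have evalX (P : {poly {poly R}}) :
    P.['X].[q] = (map_poly (horner_eval q) P).[q].
  by rewrite -{3}[q](hornerX q) (horner_map (horner_eval q)).
rewrite integral_horner// !(hornerD, hornerN, hornerC).
by rewrite horner2_map_poly evalX map_primitive_horner_eval.
Qed.

Fixpoint iterated_poly c : {poly {poly R}} :=
  if c is m :: c' then integral_poly ('X^(m.-1) * iterated_poly c') else 1.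

Lemma rev_iterated_integralE q u c : q <= u ->
  rev_iterated_integral q c u = (iterated_poly c).[u, q].
Proof.
elim: c u => [|m c IH] u qu /=; first by rewrite !hornerE.
rewrite -integral_polyE//; apply: eq_Rintegral => t.
by rewrite inE /= in_itv /= => /andP[qt _]; rewrite IH// !hornerE.
Qed.

Lemma exists_poly_iterated_integral k (c : 'I_k -> nat) :
  exists p, forall q, q <= 1 -> iterated_integral q c = p.[q].
Proof.
exists (iterated_poly (rev [seq c s | s <- enum 'I_k])).[1%:P] => q q1.
exact: rev_iterated_integralE.
Qed.

Lemma continuous_horner2 Q q : continuous (fun t : R => Q.[t, q]).
Proof.
rewrite (_ : (fun t => _) = horner (map_poly (horner_eval q) Q)).
  exact: continuous_horner.
by apply/funext => t; exact: horner2_map_poly.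
Qed.

End iterated_integrals.

(** * Volume of a set fibred over a simplex of decreasing rows *)

Section decreasing_rows.
Context {R : realType}.
Local Notation mu := (@lebesgue_measure R).

Definition decreasing_rows k (q u : R) : set 'rV[R]_k :=
  [set s | (forall i, q <= s 0 i <= u) /\
           forall i j : 'I_k, (i <= j)%N -> s 0 j <= s 0 i].

Lemma monotone_factors_rev_ord k (q u : R) (s : 'rV[R]_k) :
  monotone_factors q u (fun t => s 0 (rev_ord t)) <-> decreasing_rows q u s.
Proof.
split=> [[s_itv s_mono]|[s_itv s_decr]]; split=> [r|r t rt]; try exact: s_itv.
- by have := s_itv (rev_ord r); rewrite rev_ordK.
- by have := s_mono (rev_ord t) (rev_ord r); rewrite !rev_ordK; apply;
    rewrite /= leq_sub2l.
- by apply: s_decr; rewrite /= leq_sub2l.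
Qed.

Lemma decreasing_rows_row_mx k (q u x : R) (s : 'rV[R]_k) :
  decreasing_rows q u (row_mx (x%:M : 'rV_1) s) <->
  q <= x <= u /\ decreasing_rows q x s.
Proof.
split=> [[xs_itv xs_decr]|[x_itv [s_itv s_decr]]].
  have := xs_itv (lshift k 0); rewrite row_mx_scalarEl => x_itv.
  split=> //; split=> [i|i j ij].
    have := xs_itv (rshift 1 i); rewrite row_mxEr => /andP[-> _] /=.
    have := xs_decr (lshift k 0) (rshift 1 i) isT.
    by rewrite row_mxEr row_mx_scalarEl.
  by have := xs_decr (rshift 1 i) (rshift 1 j) ij; rewrite !row_mxEr.
split=> [i|i j].
  case: (split_ordP i) => j ->; first by rewrite ord1 row_mx_scalarEl.
  rewrite row_mxEr; have /andP[-> /le_trans-> //] := s_itv j.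
  by case/andP: x_itv.
case: (split_ordP i) => i' ->; case: (split_ordP j) => j' ->;
  rewrite ?ord1 ?row_mxEr ?row_mx_scalarEl//.
  by move=> _; case/andP: (s_itv j').
by rewrite /= !add1n ltnS; exact: s_decr.
Qed.

Lemma lebesgue_row_slices_itv n (A : set 'rV[R]_(1 + n)) (f : R -> R)
    (q u : R) :
  measurable_rows A -> continuous f ->
  {ae mu, forall x, lebesgue_row (row_slice A x%:M) =
    (if q <= x <= u then f x else 0)%:E} ->
  lebesgue_row A = (\int[mu]_(x in `[q, u]) f x)%:E.
Proof.
move=> mA f_cont slices.
have f_int : mu.-integrable `[q, u] (EFin \o f).
  apply: continuous_compact_integrable; first exact: segment_compact.
  exact: continuous_subspaceT.
rewrite /Rintegral fineK ?integrable_fin_num//.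
rewrite lebesgue_row_integral_slice [RHS]integral_mkcond.
apply: ae_eq_integral => //.
- exact: measurable_lebesgue_row_slice.
- apply/measurable_restrict => //; rewrite setTI.
  by apply/measurable_EFinP;
    apply: measurable_funS (continuous_measurable_fun f_cont).
apply: filterS slices; first exact: (ae_filter_ringOfSetsType mu).
move=> x slice_x _; rewrite slice_x patchE mem_setE in_itv /=.
by case: ifP.
Qed.

Definition decreasing_density k (q u : R) (c : 'I_k -> nat)
    (s : 'rV[R]_k) : R :=
  if s \in decreasing_rows q u then \prod_i s 0 i ^+ (c i).-1 else 0.

Lemma decreasing_density_row_mx k (q u x : R) (c : 'I_(1 + k) -> nat)
    (s : 'rV[R]_k) :
  decreasing_density q u c (row_mx (x%:M : 'rV_1) s) =
  (if q <= x <= u then x ^+ (c ord0).-1 else 0) *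
    decreasing_density q x (c \o lift ord0) s.
Proof.
rewrite /decreasing_density.
have -> : ((row_mx x%:M s : 'rV_(1 + k)) \in decreasing_rows q u) =
    (q <= x <= u) && (s \in decreasing_rows q x).
  by apply/idP/andP; rewrite !inE => /decreasing_rows_row_mx.
case: (q <= x <= u) => /=; last by rewrite mul0r.
case: ifP => _; last by rewrite mulr0.
rewrite big_split_ord big_ord1 row_mx_scalarEl; congr (_ ^+ (c _).-1 * _).
  exact/val_inj.
by apply: eq_bigr => i _; rewrite row_mxEr; congr (_ ^+ (c _).-1);
  exact/val_inj.
Qed.

Lemma lebesgue_row_decreasing_slices k d (q u V : R) (c : 'I_k -> nat)
    (A : set 'rV[R]_(k + d)) : measurable_rows A ->
  (forall s : 'rV[R]_k, (forall i, s 0 i != 0) ->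
    lebesgue_row (row_slice A s) = (V * decreasing_density q u c s)%:E) ->
  lebesgue_row A =
    (V * rev_iterated_integral q [seq c i | i <- enum 'I_k] u)%:E.
Proof.
elim: k u V c A => [u V c A mA slices|k IH u V];
    last rewrite -[k.+1]/(1 + k)%N => c A mA slices.
  have := slices 0; rewrite /decreasing_density big_ord0 mem_set;
    last by split=> [[]|[]].
  rewrite enum_ord0 /= => <-; last by case.
  by congr lebesgue_row; apply/seteqP; split => v;
    rewrite /row_slice /= row_thin_mx.
pose B : set 'rV[R]_(1 + (k + d)) := A; have mB : measurable_rows B := mA.
rewrite -[(1 + k)%N]/k.+1 enum_ordSl /= -map_comp.
set c' := [seq _ | i <- _].
pose Q : {poly {poly R}} := 'X^((c ord0).-1) * iterated_poly c'.
have QE x : q <= x ->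
    Q.[x, q] = x ^+ (c ord0).-1 * rev_iterated_integral q c' x.
  by move=> qx; rewrite rev_iterated_integralE// !hornerE.
have Q_int : mu.-integrable `[q, u] (EFin \o (fun x => Q.[x, q])).
  apply: continuous_compact_integrable; first exact: segment_compact.
  by apply: continuous_subspaceT; exact: continuous_horner2.
have slice_volume x : x != 0 -> lebesgue_row (row_slice B x%:M) =
    (if q <= x <= u then V * Q.[x, q] else 0)%:E.
  move=> x0; pose Vx := V * (if q <= x <= u then x ^+ (c ord0).-1 else 0).
  rewrite (IH x Vx (c \o lift ord0) _ (measurable_row_slice _ mB)) => [|s s0].
    by rewrite /Vx; case: ifP => [/andP[qx _]|_];
      rewrite ?mulr0 ?mul0r// QE// mulrA.
  rewrite -mulrA -decreasing_density_row_mx -slices => [|i]; last first.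
    by case: (split_ordP i) => j ->;
      rewrite ?row_mxEr// ord1 row_mx_scalarEl.
  by congr lebesgue_row; apply/seteqP; split => v;
    rewrite /row_slice /= row_mxA castmx_id.
rewrite (@lebesgue_row_slices_itv _ B (fun x => V * Q.[x, q]) q u)//.
- rewrite RintegralZl//; congr (_ * _)%:E; apply: eq_Rintegral => x.
  by rewrite inE /= in_itv /= => /andP[qx _]; exact: QE.
- by move=> x; apply: cvgM; [exact: cvg_cst|exact: continuous_horner2].
- exists [set 0]; split; [exact: measurable_set1|exact: lebesgue_measure_set1|].
  by move=> x /= slice_neq; apply: contrapT => /eqP /slice_volume.
Qed.

End decreasing_rows.

(** * The volume of the lifting *)

Lemma rev_enum_ord k : rev (enum 'I_k) = [seq rev_ord r | r <- enum 'I_k].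
Proof.
apply: (inj_map val_inj); rewrite map_rev val_enum_ord -map_comp.
rewrite (_ : _ \o _ = (fun i => k - i.+1)%N \o val)// map_comp val_enum_ord.
apply: (@eq_from_nth _ 0%N) => [|i];
  rewrite size_rev ?size_map// size_iota => ik.
rewrite nth_rev ?size_iota// (nth_map 0%N) ?size_iota// !nth_iota//.
by rewrite ltn_subrL (leq_trans _ ik).
Qed.

Lemma card_fiber_neq0 (R : numDomainType) n k (blk : 'I_n -> 'I_k) s :
  (exists i, blk i = s) -> #|fiber blk s|%:R != 0 :> R.
Proof.
move=> [i <-]; rewrite pnatr_eq0 -lt0n.
by apply/card_gt0P; exists i; rewrite in_fiber.
Qed.

Lemma sum_fiber_const (R : pzSemiRingType) n k (blk : 'I_n -> 'I_k)
    (f : 'I_k -> R) s :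
  \sum_(i in fiber blk s) f (blk i) = #|fiber blk s|%:R * f s.
Proof.
rewrite (eq_bigr (fun=> f s)) => [|i]; last by rewrite in_fiber => /eqP ->.
by rewrite sumr_const mulr_natl.
Qed.

Section block_indicators.
Context {R : comNzRingType} {n k : nat}.
Variable blk : 'I_n -> 'I_k.

(* The blocks are listed in reverse order: the first coordinate of a row is the
   outermost variable for Fubini, that is, the variable t_k. *)
Definition block_indicators : 'M[R]_(k, n) :=
  \matrix_(r, i) (blk i == rev_ord r)%:R.

Lemma mulmx_block_indicators_tr p (X : 'M[R]_(p, n)) a r :
  (X *m block_indicators^T) a r = \sum_(i in fiber blk (rev_ord r)) X a i.
Proof.
rewrite mxE [RHS]big_mkcond; apply: eq_bigr => i _; rewrite !mxE in_fiber.
by case: ifP; rewrite ?mulr1 ?mulr0.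
Qed.

Lemma mulmx_block_indicators (s : 'rV[R]_k) i :
  (s *m block_indicators) 0 i = s 0 (rev_ord (blk i)).
Proof.
rewrite mxE (bigD1 (rev_ord (blk i)))//= big1 => [|r ri].
  by rewrite mxE rev_ordK eqxx mulr1 addr0.
by rewrite mxE -(inj_eq rev_ord_inj) rev_ordK eq_sym (negbTE ri) mulr0.
Qed.

Lemma block_indicators_gram : block_indicators *m block_indicators^T =
  diag_mx (\row_r #|fiber blk (rev_ord r)|%:R).
Proof.
apply/matrixP => r t; rewrite mulmx_block_indicators_tr !mxE.
rewrite (eq_bigr (fun i => (blk i == rev_ord r)%:R)) => [|i _];
  last by rewrite mxE.
rewrite (sum_fiber_const blk (fun s => (s == rev_ord r)%:R))
  (inj_eq rev_ord_inj) eq_sym.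
by case: eqVneq => [->|]; rewrite ?mulr1 ?mulr0.
Qed.

End block_indicators.

Section block_frame.
Context {R : realType} {k d : nat}.
Variables (blk : 'I_(k + d) -> 'I_k) (M : 'M[R]_(d, k + d)).
Hypothesis blk_surj : forall s, exists i, blk i = s.
Hypotheses (orthoM : M *m M^T = 1%:M)
           (M_sum0 : M *m (block_indicators blk)^T = 0).
Local Notation D := (@block_indicators R _ _ blk).

Lemma block_indicators_orthogonal : D *m M^T = 0.
Proof. by rewrite -[LHS]trmxK trmx_mul trmxK M_sum0 trmx0. Qed.

Lemma block_frame_unitmx : col_mx D M \in unitmx.
Proof.
have : \det (col_mx D M *m (col_mx D M)^T) != 0.
  rewrite tr_col_mx mul_col_row orthoM M_sum0 block_indicators_orthogonal.
  rewrite block_indicators_gram det_ublock det1 mulr1 det_diag.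
  by apply/prodf_neq0 => r _; rewrite mxE card_fiber_neq0.
by rewrite det_mulmx mulf_eq0 negb_or unitmxE unitfE => /andP[].
Qed.

Lemma block_sum0_proj p (X : 'M[R]_(p, k + d)) :
  X *m D^T = 0 -> X *m M^T *m M = X.
Proof.
move=> X_sum0; apply/eqP; rewrite -subr_eq0.
have frame_unit : (col_mx D M)^T \in unitmx.
  by rewrite unitmx_tr block_frame_unitmx.
apply/eqP; rewrite -[LHS](mulmxK frame_unit).
rewrite tr_col_mx mul_mx_row !mulmxBl X_sum0 -!mulmxA orthoM M_sum0.
by rewrite !mulmx0 mulmx1 !subrr row_mx0 mul0mx.
Qed.

Section block_inverse_scaling.
Variable s : 'rV[R]_k.

Definition block_inverse_scaling : 'M[R]_(k + d) :=
  diag_mx (\row_i (s 0 (rev_ord (blk i)))^-1).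

Definition block_inverse_scaling_coords : 'M[R]_d :=
  M *m block_inverse_scaling *m M^T.

Let D_scaling : D *m block_inverse_scaling = diag_mx (\row_r (s 0 r)^-1) *m D.
Proof.
apply/matrixP => r i; rewrite mul_mx_diag mul_diag_mx !mxE mulrC.
by case: eqVneq => [->|]; rewrite ?rev_ordK ?mulr0.
Qed.

Lemma block_inverse_scaling_coordsE :
  block_inverse_scaling_coords *m M = M *m block_inverse_scaling.
Proof.
apply: block_sum0_proj; rewrite -mulmxA -[block_inverse_scaling]trmxK -trmx_mul.
rewrite [block_inverse_scaling^T]tr_diag_mx D_scaling trmx_mul mulmxA M_sum0.
exact: mul0mx.
Qed.

Lemma det_block_inverse_scaling_coords : (forall r, s 0 r != 0) ->
  (\det block_inverse_scaling_coords)^-1 =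
    \prod_r s 0 r ^+ #|fiber blk (rev_ord r)|.-1.
Proof.
move=> s0; set K := block_inverse_scaling_coords.
have frame_scaling : col_mx D M *m block_inverse_scaling =
    block_mx (diag_mx (\row_r (s 0 r)^-1)) 0 0 K *m col_mx D M.
  rewrite mul_block_col !mul0mx addr0 add0r mul_col_mx D_scaling.
  by rewrite block_inverse_scaling_coordsE.
have det_eq : \det block_inverse_scaling = \prod_r (s 0 r)^-1 * \det K.
  have /mulIf detDM : \det (col_mx D M) != 0.
    by rewrite -unitfE -unitmxE block_frame_unitmx.
  apply: detDM; rewrite mulrC -det_mulmx frame_scaling.
  rewrite det_mulmx det_ublock det_diag.
  by congr (_ * _ * _); apply: eq_bigr => r _; rewrite mxE.
have -> : (\det K)^-1 = \prod_r (s 0 r)^-1 / \det block_inverse_scaling.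
  rewrite det_eq invfM mulrA mulfV ?mul1r//.
  by apply/prodf_neq0 => r _; rewrite invr_eq0.
rewrite det_diag (partition_big blk xpredT)//= (reindex_inj rev_ord_inj) /=.
rewrite -prodf_div [RHS](reindex_inj rev_ord_inj) /=; apply: eq_bigr => r _.
rewrite rev_ordK (eq_bigr (fun=> (s 0 (rev_ord r))^-1)) => [|i /eqP <-];
  last by rewrite mxE.
rewrite prodr_const exprVn invrK mulrC (_ : #|_| = #|fiber blk r|);
  last by rewrite cardsE.
have := card_fiber_neq0 R (blk_surj r); rewrite pnatr_eq0.
by case: #|_| => // m _; rewrite exprS mulrAC mulfV ?mul1r.
Qed.

End block_inverse_scaling.
End block_frame.

Section lifting_volume.
Context {R : realType} {k d : nat}.
Variables (z : {set 'I_(k + d)} -> R) (blk : 'I_(k + d) -> 'I_k).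
Hypotheses (z0 : z finset.set0 = 0) (z_super : supermodular z).
Hypothesis blk_surj : forall s, exists i, blk i = s.
Local Notation pi := (fiber blk).

Definition block_center : 'rV[R]_(k + d) :=
  \row_i (block_height z pi (blk i) / #|pi (blk i)|%:R).

Lemma sum_block_center s :
  \sum_(i in pi s) block_center 0 i = block_height z pi s.
Proof.
under eq_bigr do rewrite mxE.
rewrite (sum_fiber_const blk (fun s => block_height z pi s / #|pi s|%:R)).
by rewrite mulrC divfK ?card_fiber_neq0.
Qed.

Section frame.
Variable M : 'M[R]_(d, k + d).
Hypotheses (orthoM : M *m M^T = 1%:M)
           (M_sum0 : M *m (block_indicators blk)^T = 0).

Lemma tight_face_sub_range :
  tight_face z pi `<=` range (flat_chart M block_center).
Proof.
move=> x /(tight_faceP _ z0 z_super)[sum_x _].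
exists ((x - block_center) *m M^T) => //; rewrite /flat_chart.
rewrite (block_sum0_proj blk_surj orthoM M_sum0); first by rewrite addrC subrK.
apply/rowP => r; rewrite mulmx_block_indicators_tr [RHS]mxE.
rewrite (eq_bigr (fun i => x 0 i - block_center 0 i)) => [|i _].
  by rewrite sumrB sum_x sum_block_center subrr.
by rewrite !mxE.
Qed.

Definition lifting_frame : 'M[R]_(k + d) :=
  let scale t := block_height z pi t / #|pi t|%:R in
  col_mx (diag_mx (\row_r scale (rev_ord r)) *m block_indicators blk) M.

Lemma mulmx_lifting_frame (s : 'rV[R]_k) (v : 'rV[R]_d) :
  row_mx s v *m lifting_frame =
  scale_blocks blk (fun t => s 0 (rev_ord t)) block_center + v *m M.
Proof.
rewrite mul_row_col; congr +%R; apply/rowP => i.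
by rewrite mulmxA mulmx_block_indicators mul_mx_diag !mxE rev_ordK.
Qed.

Hypothesis height_gt0 : forall s, 0 < block_height z pi s.

Lemma norm_det_lifting_frame : `|\det lifting_frame| =
  (\prod_s block_height z pi s) / Num.sqrt (\prod_s #|pi s|%:R).
Proof.
have det_sqr : \det lifting_frame ^+ 2 =
    (\prod_s block_height z pi s) ^+ 2 / \prod_s #|pi s|%:R.
  rewrite expr2 -{2}det_tr -det_mulmx /lifting_frame tr_col_mx mul_col_row.
  rewrite orthoM trmx_mul tr_diag_mx !mulmxA M_sum0 mul0mx.
  rewrite -[diag_mx _ *m _ *m M^T]mulmxA block_indicators_orthogonal// mulmx0.
  rewrite det_ublock det1 mulr1 -[diag_mx _ *m _ *m _]mulmxA.
  rewrite block_indicators_gram !mulmx_diag det_diag.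
  rewrite -prodrXl -prodf_div [RHS](reindex_inj rev_ord_inj) /=;
    apply: eq_bigr => r _.
  by rewrite !mxE; field; rewrite card_fiber_neq0.
have height_ge0 : 0 <= \prod_s block_height z pi s.
  by apply: prodr_ge0 => s _; exact: ltW.
rewrite -sqrtr_sqr det_sqr sqrtrM ?sqr_ge0// sqrtr_sqr ger0_norm// sqrtrV//.
by apply: prodr_ge0 => s _; rewrite ler0n.
Qed.

Lemma block_ratio_lifting_frame s v t :
  block_ratio z blk t (row_mx s v *m lifting_frame) = s 0 (rev_ord t).
Proof.
have vM_sum0 : \sum_(i in pi t) (v *m M) 0 i = 0.
  by rewrite -[t]rev_ordK -mulmx_block_indicators_tr -mulmxA M_sum0 mulmx0 mxE.
rewrite mulmx_lifting_frame /block_ratio.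
under eq_bigr do rewrite mxE.
rewrite big_split /= vM_sum0 addr0.
rewrite (sum_scale_blocks _ _ (fintype.subxx (pi t))).
by rewrite sum_block_center mulfK// gt_eqF.
Qed.

Lemma lifting_polyhedron_slice q (s : 'rV[R]_k) :
  0 <= q -> (forall r, s 0 r != 0) ->
  row_slice [set y | lifting_polyhedron z blk q (y *m lifting_frame)] s =
  if s \in decreasing_rows q 1 then
    [set v | tight_face z pi
       (flat_chart M block_center (v *m block_inverse_scaling_coords blk M s))]
  else set0.
Proof.
move=> q0 s0; pose rho t := s 0 (rev_ord t).
have ratioE v : block_ratio z blk^~ (row_mx s v *m lifting_frame) = rho.
  by apply/funext => t; exact: block_ratio_lifting_frame.
case: ifPn => [|not_decr]; last first.
  apply/seteqP; split => // v [+ _];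
    rewrite ratioE => /monotone_factors_rev_ord s_decr.
  by move: not_decr; rewrite mem_set.
rewrite inE => /monotone_factors_rev_ord rho_mono.
pose face_point v :=
  flat_chart M block_center (v *m block_inverse_scaling_coords blk M s).
have frameE v :
    row_mx s v *m lifting_frame = scale_blocks blk rho (face_point v).
  rewrite mulmx_lifting_frame /face_point /flat_chart -mulmxA.
  rewrite (block_inverse_scaling_coordsE blk_surj orthoM M_sum0) mulmxA.
  apply/rowP => i; rewrite mul_mx_diag !mxE mulrDr; congr +%R.
  by rewrite mulrC -mulrA mulVf ?mulr1 ?s0.
have scale_inj : injective (scale_blocks blk rho).
  move=> x y /rowP xy; apply/rowP => i; have := xy i; rewrite !mxE.
  by move=> /mulfI; apply; exact: s0.
apply/seteqP; split => v; rewrite /row_slice /= -/(face_point v) frameE.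
  move=> Ly.
  have [x Fx] := lifting_polyhedron_scale_blocks z0 z_super height_gt0 q0 Ly.
  by rewrite -frameE ratioE frameE => /scale_inj ->.
by move=> Fv; exact: scale_blocks_lifting_polyhedron.
Qed.

Lemma lebesgue_row_lifting_slice q V (s : 'rV[R]_k) :
  0 <= q -> (forall r, s 0 r != 0) ->
  lebesgue_row (flat_chart M block_center @^-1` tight_face z pi) = V%:E ->
  lebesgue_row
    (row_slice [set y | lifting_polyhedron z blk q (y *m lifting_frame)] s) =
    (V * decreasing_density q 1 (fun r => #|pi (rev_ord r)|) s)%:E.
Proof.
move=> q0 s0 VE; rewrite lifting_polyhedron_slice// /decreasing_density.
case: ifPn => [|_]; last by rewrite lebesgue_row_set0 mulr0.
rewrite inE => -[s_itv _].
have detK := det_block_inverse_scaling_coords blk_surj orthoM M_sum0 s0.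
set K := block_inverse_scaling_coords blk M s in detK *.
have Ku : K \in unitmx.
  rewrite unitmxE unitfE -invr_eq0 detK.
  by apply/prodf_neq0 => r _; rewrite expf_neq0.
have mF := measurable_flat_chart M block_center (measurable_tight_face z blk).
have := scales_volume_unitmx Ku mF; rewrite VE -normfV detK => -> /=.
rewrite mulrC ger0_norm//; apply: prodr_ge0 => r _.
by have /andP[qs _] := s_itv r; rewrite exprn_ge0// (le_trans q0).
Qed.

Lemma lebesgue_row_lifting_polyhedron q V : 0 <= q ->
  lebesgue_row (flat_chart M block_center @^-1` tight_face z pi) = V%:E ->
  lebesgue_row (lifting_polyhedron z blk q) =
    (`|\det lifting_frame| * (V * iterated_integral q (fun s => #|pi s|)))%:E.
Proof.
move=> q0 VE; set L := lifting_polyhedron z blk q; set B := lifting_frame.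
have mL : measurable_rows L := measurable_lifting_polyhedron z blk q.
have detB_gt0 : 0 < `|\det B|.
  rewrite norm_det_lifting_frame divr_gt0 ?prodr_gt0// sqrtr_gt0.
  rewrite prodr_gt0// => s _.
  by rewrite lt_neqAle eq_sym card_fiber_neq0 ?ler0n.
have Bu : B \in unitmx by rewrite unitmxE unitfE -normr_gt0.
have mLB : measurable_rows [set y | L (y *m B)] by exact: measurable_rows_mulmx.
have slices (s : 'rV[R]_k) s0 := lebesgue_row_lifting_slice (s := s) q0 s0 VE.
have := scales_volume_unitmx Bu mL.
rewrite (lebesgue_row_decreasing_slices mLB slices) => volume_eq.
rewrite EFinM /iterated_integral -map_rev rev_enum_ord -map_comp volume_eq.
by rewrite muleA -EFinM mulfV ?gt_eqF// mul1e.
Qed.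

End frame.

Let exists_frame : exists2 M : 'M[R]_(d, k + d),
  M *m M^T = 1%:M & M *m (block_indicators blk)^T = 0.
Proof. by apply: exists_orthonormal_ker; rewrite addnC. Qed.

Lemma flat_volume_tight_face_fin_num :
  flat_volume d (tight_face z pi) \is a fin_num.
Proof.
have [M orthoM M_sum0] := exists_frame; have [C PC] := polytope_of_bounded z.
apply: (flat_volume_bounded_fin_num (b := block_center) (C := C) orthoM).
- exact: measurable_tight_face.
- exact: tight_face_sub_range.
- by move=> x [Px _]; exact: PC.
Qed.

Lemma lebesgue_row_lifting q :
  (forall s, 0 < block_height z pi s) -> 0 <= q <= 1 ->
  lebesgue_row (lifting pi q (tight_face z pi)) =
    (((\prod_s block_height z pi s) / Num.sqrt (\prod_s #|pi s|%:R))%:E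
     * flat_volume d (tight_face z pi)
     * (iterated_integral q (fun s => #|pi s|))%:E)%E.
Proof.
move=> height_gt0 q01; have /andP[q0 _] := q01.
have [M orthoM M_sum0] := exists_frame.
have volumeE := flat_volumeE orthoM (measurable_tight_face z blk)
  (tight_face_sub_range orthoM M_sum0).
have /esym VE := fineK flat_volume_tight_face_fin_num; rewrite {1}volumeE in VE.
rewrite lifting_tight_face//.
rewrite (lebesgue_row_lifting_polyhedron orthoM M_sum0 height_gt0 q0 VE).
by rewrite norm_det_lifting_frame// volumeE VE -!EFinM mulrA.
Qed.

End lifting_volume.

Theorem theorem5p9 (R : realType) (n k : nat) (z : {set 'I_n} -> R)
    (z0 : z (finset.set0) = 0) (z_super : supermodular z)
    (P_pos : forall t : 'rV[R]_n, polytope_of z t -> forall i, 0 < t 0 i)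
    (pi : 'I_k -> {set 'I_n}) (pi_part : ordered_partition pi)
    (a : 'rV[R]_n) (a_type : has_type pi a) :
  let P_pi := max_face (polytope_of z) a in
  (forall q : R, 0 <= q <= 1 ->
     lebesgue_row (lifting pi q P_pi) =
       (((\prod_s block_height z pi s)
           / Num.sqrt (\prod_s (#|pi s|)%:R))%:E
        * flat_volume (n - k) P_pi
        * (iterated_integral q (fun s => #|pi s|))%:E)%E) /\
  (exists p : {poly R}, forall q : R, 0 <= q <= 1 ->
     lebesgue_row (lifting pi q P_pi) = (p.[q])%:E).
Proof.
move=> P_pi; have [blk blk_surj pi_fiber] := ordered_partition_fiber pi_part.
have k_le_n : (k <= n)%N.
  have [f fK] := choice blk_surj; rewrite -(card_ord k) -(card_ord n).
  exact: leq_card (can_inj fK).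
have [d nE] : exists d, n = (k + d)%N by exists (n - k)%N; rewrite subnKC.
subst n pi; rewrite /P_pi addKn.
rewrite (max_face_tight_face z0 z_super blk_surj a_type).
have height_gt0 s : 0 < block_height z (fiber blk) s by exact: block_height_gt0.
have volume q := lebesgue_row_lifting z0 z_super blk_surj (q := q) height_gt0.
have fin_volume := flat_volume_tight_face_fin_num z0 z_super blk_surj.
have [p pE] := @exists_poly_iterated_integral R _ (fun s => #|fiber blk s|).
set c := (\prod_s block_height z (fiber blk) s) / _ in volume *.
split=> //; exists (c * fine (flat_volume d (tight_face z (fiber blk))) *: p).
move=> q q01; have /andP[_ q1] := q01.
by rewrite volume// -(fineK fin_volume) -!EFinM pE// hornerZ.
Qed.
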